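(* Consider the problem, the Lagrangian $\mathcal L$ and the NPGA iteration described in the context. Assume: (1) $\mathcal{L}$ has at least one saddle point; (2) the network graph is undirected and connected; (3) for every $i$, $f_i$ is $\mu_i$-strongly convex and $l_i$-smooth with $l_i\ge\mu_i>0$, and $g_i$ and $h$ are proper, convex and lower semicontinuous; put $\mu=\min_i\mu_i$, $l=\max_i l_i$; (4) the symmetric matrices $B,C,D\in\mathbb{R}^{n\times n}$ satisfy: $C=0$ or $\mathrm{Null}(C)=\mathrm{Span}(\mathbf 1_n)$; $\mathrm{Null}(B)=\mathrm{Span}(\mathbf 1_n)$; $0\le C<I$ and $B^2\le I$; $D$ is symmetric doubly stochastic; (5) $h$ is $l_h$-smooth for some $l_h>0$. Let $\mathbf y^0=0$, $0\le\theta\le1$, and let the positive step-sizes $\alpha,\beta,\gamma$ satisfy $$\alpha<\frac{1}{\max\left\{\frac{2\theta l^2}{\mu},\,2l-\mu\right\}},\qquad \beta\le\frac{\mu}{\overline\sigma^2(\mathbf A)\left(\frac{1}{1-\overline\sigma(C)}+\theta\right)},\qquad \gamma<\min\left\{1,\frac{\left(1+\frac{\beta}{nl_h}\right)^2-1}{\left(1+\frac{\beta}{nl_h}\right)^2\overline\sigma^2(B)}\right\}.$$ Then $$\delta=\max\left\{1-\alpha\left(\mu-2\theta\alpha l^2\right),\ \frac{1}{\left(1+\frac{\beta}{nl_h}\right)^2\left(1-\gamma\overline\sigma^2(B)\right)},\ 1-\gamma\underline\sigma^2(B)\right\}$$ lies in $(0,1)$, and the NPGA iterates satisfy $\|\mathbf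 x^k-\mathbf x^*\|^2=\mathcal O(\delta^k)$.
   Context: Problem: $n$ agents solve $\min_{x_i\in\mathbb R^{d_i}}\sum_{i=1}^n (f_i(x_i)+g_i(x_i))+h\left(\sum_{i=1}^n A_ix_i\right)$, where $f_i:\mathbb R^{d_i}\to\mathbb R$, $g_i:\mathbb R^{d_i}\to\mathbb R\cup\{+\infty\}$, $h:\mathbb R^p\to\mathbb R\cup\{+\infty\}$, $A_i\in\mathbb R^{p\times d_i}$; the solution set is assumed nonempty. Let $d=\sum_i d_i$, $\mathbf x=[x_1^\top,\dots,x_n^\top]^\top\in\mathbb R^d$, $f(\mathbf x)=\sum_i f_i(x_i)$, $g(\mathbf x)=\sum_i g_i(x_i)$, $A=[A_1,\dots,A_n]\in\mathbb R^{p\times d}$, $\mathbf A=\mathrm{diag}(A_1,\dots,A_n)\in\mathbb R^{np\times d}$ (block diagonal). $h^*$ is the Fenchel conjugate of $h$. The Lagrangian is $\mathcal L(\mathbf x,\lambda)=f(\mathbf x)+g(\mathbf x)+\lambda^\top A\mathbf x-h^*(\lambda)$ for $\lambda\in\mathbb R^p$ (min over $\mathbf x$, max over $\lambda$). ''$L$-smooth'' means (finite-valued and) differentiable with $L$-Lipschitz gradient. Notation: for symmetric matrices, $M\le N$ ($M<N$) means $N-M$ is positive semidefinite (positive definite). $\overline\sigma(\cdot)$ and $\underline\sigma(\cdot)$ are the largest and the smallest non-zero singular values. $\mathbf 1_n$ is the all-ones vector. $\mathrm{prox}_{\alpha \phi}(x)=\arg\min_y \phi(y)+\frac1{2\alpha}\|y-x\|^2$.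 The network is a graph on the agents $\{1,\dots,n\}$; $B,C,D\in\mathbb R^{n\times n}$ are symmetric matrices associated with it, $\mathbf B=B\otimes I_p$, $\mathbf C=C\otimes I_p$, $\mathbf D=D\otimes I_p$. For $\boldsymbol\lambda=[\lambda_1^\top,\dots,\lambda_n^\top]^\top\in\mathbb R^{np}$ put $\mathbf h(\boldsymbol\lambda)=\frac1n\sum_{i=1}^n h^*(\lambda_i)$. NPGA: given parameters $\alpha,\beta,\gamma>0$, $\theta\ge0$ and initial points $\mathbf x^0\in\mathbb R^d$, $\boldsymbol\lambda^0\in\mathbb R^{np}$ (arbitrary) and $\mathbf y^0\in\mathbb R^{np}$, for $k\ge0$: $\mathbf x^{k+1}=\mathrm{prox}_{\alpha g}(\mathbf x^k-\alpha(\nabla f(\mathbf x^k)+\mathbf A^\top\boldsymbol\lambda^k))$, $\hat{\mathbf x}^{k+1}=\mathbf x^{k+1}+\theta(\mathbf x^{k+1}-\mathbf x^k)$, $\mathbf v^{k+1}=\boldsymbol\lambda^k-\mathbf C\boldsymbol\lambda^k-\mathbf B\mathbf y^k+\beta\mathbf A\hat{\mathbf x}^{k+1}$, $\mathbf y^{k+1}=\mathbf y^k+\gamma\mathbf B\mathbf v^{k+1}$, $\boldsymbol\lambda^{k+1}=\mathrm{prox}_{\beta\mathbf h}(\mathbf D\mathbf v^{k+1})$. $\mathbf x^*$ denotes the (unique) solution of the problem, i.e. the $\mathbf x$-component of the saddle point of $\mathcal L$. *)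

(* Defs.v *)
(* MathComp-Analysis; the reals are an arbitrary R : realType. *)
From HB Require Import structures.
From mathcomp Require Import all_boot all_order all_algebra.
From mathcomp Require Import all_classical all_reals all_analysis.
Import Order.TTheory GRing.Theory Num.Theory.
Import numFieldNormedType.Exports.

Set Implicit Arguments.
Unset Strict Implicit.
Unset Printing Implicit Defensive.

Local Open Scope classical_set_scope.
Local Open Scope ring_scope.

(** * Euclidean structure of column vectors *)

(* The library norm on 'cV[R]_m is the sup norm (it induces the same topology,
   hence the same notion of differentiability); all estimates below are in the
   Euclidean norm. *)
Definition dotp (R : realType) (m : nat) (u v : 'cV[R]_m) : R :=
  (u^T *m v) 0 0.

Definition enorm (R : realType) (m : nat) (u : 'cV[R]_m) : R :=
  Num.sqrt (dotp u u).

Definition grad (R : realType) (m : nat) (phi : 'cV[R]_m -> R) (x : 'cV[R]_m) :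
    'cV[R]_m :=
  \col_j derive phi x (delta_mx j 0).

Definition lsmooth (R : realType) (m : nat) (L : R) (phi : 'cV[R]_m -> R) :
    Prop :=
  (forall x, differentiable phi x) /\
  (forall x y, enorm (grad phi x - grad phi y) <= L * enorm (x - y)).

Definition strongly_convex (R : realType) (m : nat) (mu : R)
    (phi : 'cV[R]_m -> R) : Prop :=
  forall (x y : 'cV[R]_m) (t : R), 0 <= t <= 1 ->
    phi (t *: x + (1 - t) *: y) <=
    t * phi x + (1 - t) * phi y - mu / 2 * t * (1 - t) * enorm (x - y) ^+ 2.

(** * Extended-real-valued convex functions *)

Definition eproper (R : realType) (m : nat) (phi : 'cV[R]_m -> \bar R) : Prop :=
  (forall x, phi x != -oo%E) /\ (exists x, phi x != +oo%E).

Definition econvex (R : realType) (m : nat) (phi : 'cV[R]_m -> \bar R) : Prop :=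
  forall (x y : 'cV[R]_m) (t : R), 0 <= t <= 1 ->
    (phi (t *: x + (1 - t)%R *: y)%R <= t%:E * phi x + (1 - t)%:E * phi y)%E.

Definition proper_convex_lsc (R : realType) (m : nat)
    (phi : 'cV[R]_m -> \bar R) : Prop :=
  [/\ eproper phi, econvex phi & lower_semicontinuous phi].

Definition elsmooth (R : realType) (m : nat) (L : R)
    (phi : 'cV[R]_m -> \bar R) : Prop :=
  (forall x, phi x \is a fin_num) /\ lsmooth L (fine \o phi).

Definition conjugate (R : realType) (m : nat) (phi : 'cV[R]_m -> \bar R)
    (z : 'cV[R]_m) : \bar R :=
  ereal_sup (range (fun x => (dotp z x)%:E - phi x)%E).

(* [is_prox a phi x y] : y is an argmin defining prox_{a phi}(x). For a > 0 and
   phi proper, convex and lsc such a y exists and is unique. *)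
Definition is_prox (R : realType) (m : nat) (a : R) (phi : 'cV[R]_m -> \bar R)
    (x y : 'cV[R]_m) : Prop :=
  forall z, (phi y + ((2 * a)^-1 * enorm (y - x)%R ^+ 2)%:E <=
             phi z + ((2 * a)^-1 * enorm (z - x)%R ^+ 2)%:E)%E.

(** * Matrices *)

Definition psdmx (R : realType) (m : nat) (M : 'M[R]_m) : Prop :=
  forall u : 'cV[R]_m, 0 <= dotp u (M *m u).

Definition pdmx (R : realType) (m : nat) (M : 'M[R]_m) : Prop :=
  forall u : 'cV[R]_m, u != 0 -> 0 < dotp u (M *m u).

(* These orders are only used on symmetric matrices. *)
Definition loewner_le (R : realType) (m : nat) (M N : 'M[R]_m) : Prop := psdmx (N - M).
Definition loewner_lt (R : realType) (m : nat) (M N : 'M[R]_m) : Prop := pdmx (N - M).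

Definition null_is_span1 (R : realType) (m : nat) (M : 'M[R]_m) : Prop :=
  [set u : 'cV[R]_m | M *m u = 0] = range (fun a : R => a *: const_mx 1).

Definition doubly_stochastic (R : realType) (m : nat) (M : 'M[R]_m) : Prop :=
  [/\ forall i j, 0 <= M i j,
      forall i, \sum_j M i j = 1
    & forall j, \sum_i M i j = 1].

Definition singular_value (R : realType) (m k : nat) (M : 'M[R]_(m, k)) (s : R) :
    Prop :=
  0 <= s /\ eigenvalue (M^T *m M) (s ^+ 2).

(* A supremum (infimum) over a finite set. [sigma_min M] is meaningful only for
   M <> 0; the library conventions give sup set0 = inf set0 = 0. *)
Definition sigma_max (R : realType) (m k : nat) (M : 'M[R]_(m, k)) : R :=
  sup [set s | singular_value M s].

Definition sigma_min (R : realType) (m k : nat) (M : 'M[R]_(m, k)) : R :=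
  inf [set s | singular_value M s /\ s != 0].

(** * Stacked vectors and matrices

   A vector of R^d with d = \sum_i d_i is an element of 'cV_(\sum_i d i), its
   i-th block being [submxcol x i]; R^{np} is 'cV_(\sum_(i < n) p). *)

Definition sepsum (R : realType) (n : nat) (d : 'I_n -> nat)
    (f : forall i, 'cV[R]_(d i) -> R) (x : 'cV[R]_(\sum_i d i)) : R :=
  \sum_i f i (submxcol x i).

Definition esepsum (R : realType) (n : nat) (d : 'I_n -> nat)
    (g : forall i, 'cV[R]_(d i) -> \bar R) (x : 'cV[R]_(\sum_i d i)) : \bar R :=
  (\sum_i g i (submxcol x i))%E.

Definition blockdiag (R : realType) (n p : nat) (d : 'I_n -> nat)
    (A : forall i, 'M[R]_(p, d i)) : 'M[R]_(\sum_(i < n) p, \sum_i d i) :=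
  \mxblock_(i < n, j < n) (if i == j then A j else 0).

(* The Kronecker product M (x) I_p, written blockwise. *)
Definition kronI (R : realType) (n p : nat) (M : 'M[R]_n) :
    'M[R]_(\sum_(i < n) p) :=
  \mxblock_(i < n, j < n) ((M i j)%:M : 'M[R]_p).

Definition hbar (R : realType) (n p : nat) (h : 'cV[R]_p -> \bar R)
    (lam : 'cV[R]_(\sum_(i < n) p)) : \bar R :=
  ((n%:R^-1)%:E * \sum_(i < n) conjugate h (submxcol lam i))%E.

(** * The problem, its Lagrangian and the algorithm *)

Definition objective (R : realType) (n p : nat) (d : 'I_n -> nat)
    (f : forall i, 'cV[R]_(d i) -> R) (g : forall i, 'cV[R]_(d i) -> \bar R)
    (h : 'cV[R]_p -> \bar R) (A : forall i, 'M[R]_(p, d i))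
    (x : 'cV[R]_(\sum_i d i)) : \bar R :=
  (\sum_i ((f i (submxcol x i))%:E + g i (submxcol x i)) +
   h (\sum_i (A i *m submxcol x i))%R)%E.

Definition solution (R : realType) (n p : nat) (d : 'I_n -> nat)
    (f : forall i, 'cV[R]_(d i) -> R) (g : forall i, 'cV[R]_(d i) -> \bar R)
    (h : 'cV[R]_p -> \bar R) (A : forall i, 'M[R]_(p, d i))
    (xs : 'cV[R]_(\sum_i d i)) : Prop :=
  forall x, (objective f g h A xs <= objective f g h A x)%E.

(* When g x = +oo and h^* lam = +oo the difference is +oo - +oo, evaluated to
   -oo; for proper g and h^* a saddle point has both values finite under either
   convention, so this choice is immaterial. *)
Definition lagrangian (R : realType) (n p : nat) (d : 'I_n -> nat)
    (f : forall i, 'cV[R]_(d i) -> R) (g : forall i, 'cV[R]_(d i) -> \bar R)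
    (h : 'cV[R]_p -> \bar R) (A : forall i, 'M[R]_(p, d i))
    (x : 'cV[R]_(\sum_i d i)) (lam : 'cV[R]_p) : \bar R :=
  ((sepsum f x)%:E + esepsum g x +
   (dotp lam ((\mxrow_i A i) *m x)%R)%:E - conjugate h lam)%E.

Definition saddle_point (R : realType) (S T : Type) (L : S -> T -> \bar R)
    (xs : S) (ls : T) : Prop :=
  (forall lam, (L xs lam <= L xs ls)%E) /\ (forall x, (L xs ls <= L x ls)%E).

(* One iteration, from (x, y, lam) to (x', y', lam'). *)
Definition npga_step (R : realType) (n p : nat) (d : 'I_n -> nat)
    (f : forall i, 'cV[R]_(d i) -> R) (g : forall i, 'cV[R]_(d i) -> \bar R)
    (h : 'cV[R]_p -> \bar R) (A : forall i, 'M[R]_(p, d i))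
    (B C D : 'M[R]_n) (alpha beta gamma theta : R)
    (x : 'cV[R]_(\sum_i d i)) (y lam : 'cV[R]_(\sum_(i < n) p))
    (x' : 'cV[R]_(\sum_i d i)) (y' lam' : 'cV[R]_(\sum_(i < n) p)) : Prop :=
  let xhat := x' + theta *: (x' - x) in
  let v := lam - kronI p C *m lam - kronI p B *m y +
           beta *: (blockdiag A *m xhat) in
  [/\ is_prox alpha (esepsum g)
        (x - alpha *: (grad (sepsum f) x + (blockdiag A)^T *m lam)) x',
      y' = y + gamma *: (kronI p B *m v)
    & is_prox beta (@hbar R n p h) (kronI p D *m v) lam'].

(* Smallest and largest value of a nonempty finite family. *)
Definition fmin (R : realType) (n : nat) (hn : (0 < n)%N) (u : 'I_n -> R) : R :=
  \big[Num.min/u (Ordinal hn)]_(i < n) u i.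
Definition fmax (R : realType) (n : nat) (hn : (0 < n)%N) (u : 'I_n -> R) : R :=
  \big[Num.max/u (Ordinal hn)]_(i < n) u i.

(* Main.v *)
(* All errors are measured from a fixed point (xs, 1 (x) lbar, ys) of the iteration, which
   exists because range B is the orthogonal complement of the consensus vectors; write e, u,
   yt for the errors of x, lam, y.

   Dual side.  Since h is lh-smooth, its conjugate is (1/lh)-strongly convex, so the dual prox
   step contracts by 1 + beta/(n lh), while D is nonexpansive.  The update of y gives the exact
   identity
     |v|^2 - gamma |B v|^2 + |yt'|^2 / gamma = |yt|^2 / gamma - |B yt|^2 + |u - C u + beta z|^2
   with z = A (e' + theta (e' - e)), and with c = sigma_max C the last term is at most
   |u|^2 + 2 beta u.z + 2/(2 - c) beta^2 |z|^2.

   Primal side.  The subgradient inequality of the prox step is tested at xs and at the previous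
   iterate x; this bounds the coupling u.z, the second test producing the telescoping gap
   G x = g x - g xs + (grad f xs + A^T lbar).(x - xs) >= 0.  The resulting Lyapunov function
     q (1 - gamma sigma_max(B)^2) |u|^2 + |yt|^2 / gamma + (beta / alpha) |e|^2
       + 2 beta (1 + theta) G
   decreases by the factor delta: the step-size bounds yield the first three terms, and the
   last one needs theta <= (1 + theta) delta, which already follows from the first entry of
   delta.  It may be infinite at the arbitrary initial point, so the induction starts at k = 1. *)
Require Import Defs.
From HB Require Import structures.
From mathcomp Require Import all_boot all_order all_algebra.
From mathcomp Require Import all_classical all_reals all_analysis.
From mathcomp Require Import ring lra.
Import Order.TTheory GRing.Theory Num.Theory.
Import numFieldNormedType.Exports.
Set Implicit Arguments.
Unset Strict Implicit.
Unset Printing Implicit Defensive.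
Local Open Scope classical_set_scope.
Local Open Scope ring_scope.

(** * Inner product *)

Lemma dotpE (R : realType) m (u v : 'cV[R]_m) : dotp u v = \sum_i u i 0 * v i 0.
Proof. by rewrite /dotp mxE; apply: eq_bigr => i _; rewrite mxE. Qed.

Lemma dotpC (R : realType) m (u v : 'cV[R]_m) : dotp u v = dotp v u.
Proof. by rewrite !dotpE; apply: eq_bigr => i _; rewrite mulrC. Qed.

Lemma dotpDl (R : realType) m (u v w : 'cV[R]_m) :
  dotp (u + v) w = dotp u w + dotp v w.
Proof. by rewrite /dotp linearD/= mulmxDl mxE. Qed.

Lemma dotpDr (R : realType) m (u v w : 'cV[R]_m) :
  dotp w (u + v) = dotp w u + dotp w v.
Proof. by rewrite /dotp mulmxDr mxE. Qed.

Lemma dotpNl (R : realType) m (u w : 'cV[R]_m) : dotp (- u) w = - dotp u w.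
Proof. by rewrite /dotp linearN/= mulNmx mxE. Qed.

Lemma dotpNr (R : realType) m (u w : 'cV[R]_m) : dotp w (- u) = - dotp w u.
Proof. by rewrite /dotp mulmxN mxE. Qed.

Lemma dotpZl (R : realType) m a (u w : 'cV[R]_m) : dotp (a *: u) w = a * dotp u w.
Proof. by rewrite /dotp linearZ/= -scalemxAl mxE. Qed.

Lemma dotpZr (R : realType) m a (u w : 'cV[R]_m) : dotp w (a *: u) = a * dotp w u.
Proof. by rewrite /dotp -scalemxAr mxE. Qed.

Definition dotp_lin :=
  (dotpDl, dotpDr, dotpNl, dotpNr, dotpZl, dotpZr).

Lemma dotp0l (R : realType) m (u : 'cV[R]_m) : dotp 0 u = 0.
Proof. by rewrite /dotp trmx0 mul0mx mxE. Qed.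

Lemma dotp0r (R : realType) m (u : 'cV[R]_m) : dotp u 0 = 0.
Proof. by rewrite dotpC dotp0l. Qed.

Lemma dotp_mulmxr (R : realType) m k (M : 'M[R]_(m, k)) u v :
  dotp u (M *m v) = dotp (M^T *m u) v.
Proof. by rewrite /dotp trmx_mul trmxK mulmxA. Qed.

Lemma dotp_ge0 (R : realType) m (u : 'cV[R]_m) : 0 <= dotp u u.
Proof. by rewrite dotpE; apply: sumr_ge0 => i _; rewrite -expr2 sqr_ge0. Qed.

Lemma dotp_eq0 (R : realType) m (u : 'cV[R]_m) : dotp u u = 0 -> u = 0.
Proof.
move=> /eqP; rewrite dotpE psumr_eq0 => [/allP u0|i _]; last first.
  by rewrite -expr2 sqr_ge0.
apply/matrixP => i j; rewrite ord1 mxE; apply/eqP.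
by move: (u0 i); rewrite mem_index_enum mulf_eq0 orbb; apply.
Qed.

Lemma dotp_gt0 (R : realType) m (u : 'cV[R]_m) : u != 0 -> 0 < dotp u u.
Proof.
move=> u0; rewrite lt_neqAle dotp_ge0 andbT eq_sym.
by apply: contra u0 => /eqP/dotp_eq0 ->.
Qed.

Lemma sqr_enorm (R : realType) m (u : 'cV[R]_m) : enorm u ^+ 2 = dotp u u.
Proof. by rewrite sqr_sqrtr ?dotp_ge0. Qed.

Lemma enorm_ge0 (R : realType) m (u : 'cV[R]_m) : 0 <= enorm u.
Proof. exact: sqrtr_ge0. Qed.

(** Discriminant of a quadratic in [t]. Nonnegativity is required only on the line [u + t *: v] and
    at [v], so the inequality also serves forms that are nonnegative on a mere subspace. *)
Lemma psd_cauchy_schwarz (R : realType) m (M : 'M[R]_m) u v :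
    M^T = M -> (forall t, 0 <= dotp (u + t *: v) (M *m (u + t *: v))) ->
  0 <= dotp v (M *m v) ->
  dotp u (M *m v) ^+ 2 <= dotp u (M *m u) * dotp v (M *m v).
Proof.
move=> MT Muv Mv.
have {}Muv t : 0 <= dotp u (M *m u) + 2 * t * dotp u (M *m v) + t ^+ 2 * dotp v (M *m v).
  have := Muv t; rewrite mulmxDr -scalemxAr !dotp_lin.
  rewrite (dotp_mulmxr M v u) MT (dotpC (M *m v)); lra.
have := Mv; rewrite le_eqVlt => /predU1P[Mv0|Mv0]; last first.
  have := Muv (- (dotp u (M *m v) / dotp v (M *m v))).
  rewrite -(ler_pM2r Mv0) mul0r; set a := dotp u _; set b := dotp v _; set c := dotp u _.
  have -> : (a + 2 * - (c / b) * c + (- (c / b)) ^+ 2 * b) * b = a * b - c ^+ 2.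
    by field; rewrite gt_eqF.
  by rewrite subr_ge0.
rewrite -Mv0 mulr0; have [->|c0] := eqVneq (dotp u (M *m v)) 0; first by rewrite expr0n.
(* The coefficient of [t ^+ 2] vanishes here, so the expression is affine in [t]; this [t] gives it
   the value -1. *)
have := Muv (- (dotp u (M *m u) + 1) / (2 * dotp u (M *m v))).
rewrite -Mv0 mulr0; set a := dotp u _; set c := dotp u _.
have -> : a + 2 * (- (a + 1) / (2 * c)) * c + 0 = -1 by field.
by move=> ?; lra.
Qed.

Lemma cauchy_schwarz (R : realType) m (u v : 'cV[R]_m) :
  dotp u v ^+ 2 <= dotp u u * dotp v v.
Proof.
have := @psd_cauchy_schwarz R m 1%:M u v (tr_scalar_mx _ _).
by rewrite !mul1mx; apply => [t|]; rewrite ?mul1mx dotp_ge0.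
Qed.

Lemma dotp_le_enorm (R : realType) m (u v : 'cV[R]_m) :
  dotp u v <= enorm u * enorm v.
Proof.
rewrite (le_trans (ler_norm _)) //.
rewrite -(ler_pXn2r (n := 2)) ?nnegrE ?mulr_ge0 ?enorm_ge0 //.
by rewrite real_normK ?num_real // exprMn !sqr_enorm cauchy_schwarz.
Qed.

(** * Singular values *)

Lemma sum_continuous (R : realType) (T : topologicalType) m (F : 'I_m -> T -> R) :
  (forall i, continuous (F i)) -> continuous (fun x => \sum_i F i x).
Proof.
by move=> cF x; apply: cvg_big => [y|i _]; [exact: add_continuous | exact: cF].
Qed.

Lemma quadratic_form_continuous (R : realType) m (S : 'M[R]_m) :
  continuous (fun u : 'rV[R]_m => dotp u^T (S *m u^T)).
Proof.
have -> : (fun u : 'rV[R]_m => dotp u^T (S *m u^T)) =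
    (fun u => \sum_i u 0 i * \sum_j S i j * u 0 j).
  apply/funext => u; rewrite dotpE; apply: eq_bigr => i _; rewrite !mxE.
  by congr (_ * _); apply: eq_bigr => j _; rewrite mxE.
apply: sum_continuous => i u; apply: continuousM; first exact: coord_continuous.
apply: sum_continuous => j {}u.
by apply: continuousM; [exact: cst_continuous | exact: coord_continuous].
Qed.

(* By compactness the Rayleigh quotient attains its minimum on the unit sphere of [Null K];
   by Cauchy-Schwarz for the form [S - c], a minimizer is an eigenvector. *)
Lemma symmetric_min_eigenvector (R : realType) m k (S : 'M[R]_m) (K : 'M[R]_(k, m)) :
    S^T = S -> (forall u : 'cV_m, K *m u = 0 -> K *m (S *m u) = 0) ->
    (exists2 u : 'cV_m, K *m u = 0 & u != 0) ->
  exists (v : 'cV[R]_m) (c : R), [/\ K *m v = 0, v != 0, S *m v = c *: v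
    & forall u : 'cV_m, K *m u = 0 -> c * dotp u u <= dotp u (S *m u)].
Proof.
move=> ST KS [u0 Ku0 u0n0].
pose Q (M : 'M[R]_m) (u : 'rV[R]_m) := dotp u^T (M *m u^T).
(* [K u = 0] is written through the form of [K^T *m K], so that both constraints are level sets of
   continuous quadratic forms and [A] is closed. *)
pose A := [set u | Q (K^T *m K) u = 0] `&` [set u | Q 1%:M u = 1].
have QK (u : 'cV[R]_m) : Q (K^T *m K) u^T = 0 <-> K *m u = 0.
  rewrite /Q trmxK -mulmxA dotp_mulmxr trmxK; split; first exact: dotp_eq0.
  by move=> ->; rewrite dotp0l.
have Q1 (u : 'cV[R]_m) : Q 1%:M u^T = dotp u u by rewrite /Q trmxK mul1mx.
have normA (u : 'cV[R]_m) : K *m u = 0 -> u != 0 ->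
    ((Num.sqrt (dotp u u))^-1 *: u)^T \in A.
  move=> Ku un0; rewrite inE; split.
    by rewrite /= QK -scalemxAr Ku scaler0.
  rewrite /= Q1 !dotp_lin mulrA -invfM -expr2 sqr_sqrtr ?dotp_ge0 //.
  by rewrite mulVf // gt_eqF // dotp_gt0.
have cA : compact A.
  apply: bounded_closed_compact.
    exists 1; split => // M M1 u [_] /=; rewrite -[u]trmxK Q1 trmxK => uu.
    rewrite (le_trans _ (ltW M1)) // /Num.norm/= mx_normrE.
    apply/bigmax_leP; split => // -[i j] _ /=; rewrite ord1.
    rewrite -(ler_pXn2r (n := 2)) ?nnegrE // expr1n real_normK ?num_real //.
    rewrite -uu dotpE (bigD1 j)//= !mxE expr2 lerDl sumr_ge0 // => a _.
    by rewrite -expr2 sqr_ge0.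
  have cQ M := @quadratic_form_continuous R m M.
  by apply: closedI; apply: (@preimage_closed _ _ _ [set _]) => [? _|];
    [exact: cQ | exact: closed_eq | exact: cQ | exact: closed_eq].
have A0 : A !=set0 by exists ((Num.sqrt (dotp u0 u0))^-1 *: u0)^T; apply/set_mem/normA.
have [v /set_mem[Kv vv] vmin] := compact_EVT_min A0 cA
  (continuous_subspaceT (@quadratic_form_continuous R m S)).
rewrite -[v]trmxK in Kv vv vmin; rewrite /= Q1 in vv; move/QK : Kv => Kv.
set w := v^T in Kv vv vmin; pose c := dotp w (S *m w).
have cle (u : 'cV_m) : K *m u = 0 -> c * dotp u u <= dotp u (S *m u).
  move=> Ku; have [->|un0] := eqVneq u 0; first by rewrite !dotp0l mulr0.
  have := vmin _ (normA u Ku un0); rewrite !trmxK -/c -scalemxAr !dotp_lin mulrA.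
  rewrite -invfM -expr2 sqr_sqrtr ?dotp_ge0 // mulrC ler_pdivlMr //.
  exact: dotp_gt0.
exists w, c; split => //.
  by apply/eqP => w0; move: vv; rewrite w0 dotp0l; lra.
pose T := S - c%:M.
have Tu u : dotp u (T *m u) = dotp u (S *m u) - c * dotp u u.
  by rewrite mulmxBl mul_scalar_mx !dotp_lin.
pose z := T *m w.
have Kz : K *m z = 0.
  by rewrite /z mulmxBl mul_scalar_mx mulmxBr KS // -scalemxAr Kv scaler0 subr0.
have T0 u : K *m u = 0 -> 0 <= dotp u (T *m u).
  by move=> Ku; rewrite Tu subr_ge0 cle.
have TT : T^T = T by rewrite linearB /= ST tr_scalar_mx.
have := @psd_cauchy_schwarz R m T w z TT _ (T0 _ Kz).
rewrite Tu vv mulr1 subrr mul0r dotp_mulmxr TT -/z.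
have Kwz t : K *m (w + t *: z) = 0 by rewrite mulmxDr -scalemxAr Kv Kz scaler0 addr0.
move=> /(_ (fun t => T0 _ (Kwz t))) zz.
have /dotp_eq0 : dotp z z = 0 by apply/eqP; rewrite -sqrf_eq0 eq_le zz sqr_ge0.
by rewrite /z mulmxBl mul_scalar_mx => /subr0_eq.
Qed.

Lemma eigenvalue_colP (R : realType) m (S : 'M[R]_m) (c : R) : S^T = S ->
  eigenvalue S c <-> exists2 v : 'cV[R]_m, S *m v = c *: v & v != 0.
Proof.
move=> ST; split => [/eigenvalueP[v Sv v0]|[v Sv v0]].
  exists v^T; last by rewrite trmx_eq0.
  by rewrite -[S in LHS]ST -trmx_mul Sv linearZ.
apply/eigenvalueP; exists v^T; last by rewrite trmx_eq0.
by rewrite -[S]ST -trmx_mul Sv linearZ.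
Qed.

Lemma gram_sym (R : realType) m k (M : 'M[R]_(k, m)) : (M^T *m M)^T = M^T *m M.
Proof. by rewrite trmx_mul trmxK. Qed.

Lemma dotp_gram (R : realType) m k (M : 'M[R]_(k, m)) u :
  dotp u (M^T *m M *m u) = dotp (M *m u) (M *m u).
Proof. by rewrite -mulmxA dotp_mulmxr trmxK. Qed.

(** Minimizing the form of [- (M^T *m M)] without constraint yields the top eigenvalue of the Gram
    matrix, so the supremum defining [sigma_max] is a maximum. The vector [u0] excludes dimension
    0. *)
Lemma sigma_max_attained (R : realType) m k (M : 'M[R]_(k, m)) (u0 : 'cV[R]_m) :
  u0 != 0 ->
  [/\ 0 <= sigma_max M,
      exists2 v : 'cV[R]_m, M^T *m M *m v = sigma_max M ^+ 2 *: v & v != 0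
    & forall u, dotp (M *m u) (M *m u) <= sigma_max M ^+ 2 * dotp u u].
Proof.
move=> u0n0; pose K : 'M[R]_(0, m) := 0.
have K0 u : K *m u = 0 :> 'cV_0 by rewrite mul0mx.
have ST : (- (M^T *m M))^T = - (M^T *m M) by rewrite linearN /= gram_sym.
have [v [c [_ v0 Sv cmin]]] := @symmetric_min_eigenvector _ _ _ _ K ST
  (fun _ _ => K0 _) (ex_intro2 _ _ u0 (K0 _) u0n0).
have {}Sv : M^T *m M *m v = - c *: v.
  by rewrite scaleNr -Sv mulNmx opprK.
have {}cmin u : dotp (M *m u) (M *m u) <= - c * dotp u u.
  by have := cmin u (K0 u); rewrite mulNmx !dotp_lin dotp_gram mulNr; lra.
have c0 : 0 <= - c.
  by have := le_trans (dotp_ge0 _) (cmin v); rewrite pmulr_lge0 // dotp_gt0.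
have ubs s : singular_value M s -> s <= Num.sqrt (- c).
  move=> [s0 /(eigenvalue_colP _ (gram_sym M))[w Sw w0]].
  rewrite -(ler_pXn2r (n := 2)) ?nnegrE ?sqrtr_ge0 // sqr_sqrtr //.
  rewrite -(ler_pM2r (dotp_gt0 w0)) -dotpZr -Sw dotp_gram; exact: cmin.
have sc : singular_value M (Num.sqrt (- c)).
  split; first exact: sqrtr_ge0.
  by rewrite sqr_sqrtr //; apply/(eigenvalue_colP _ (gram_sym M)); exists v.
have -> : sigma_max M = Num.sqrt (- c).
  apply/eqP; rewrite eq_le; apply/andP; split.
    by apply: ge_sup; [exists (Num.sqrt (- c)) | move=> s /ubs].
  by apply: ub_le_sup => //; exists (Num.sqrt (- c)) => s /ubs.
rewrite sqr_sqrtr // sqrtr_ge0; split => //.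
by exists v.
Qed.

Lemma dotp_mulmx_le (R : realType) m k (M : 'M[R]_(k, m)) (u : 'cV[R]_m) :
  dotp (M *m u) (M *m u) <= sigma_max M ^+ 2 * dotp u u.
Proof.
have [->|/(sigma_max_attained M)[_ _]//] := eqVneq u 0.
by rewrite mulmx0 !dotp0l mulr0.
Qed.

(** The kernel of [K] contains the range of [B] and meets the kernel of [B] trivially, so the least
    eigenvalue of [B^T *m B] on it is positive. Every eigenvector with nonzero eigenvalue lies
    there, hence this eigenvalue is the squared smallest nonzero singular value. *)
Lemma sigma_min_bound (R : realType) m k (B : 'M[R]_m) (K : 'M[R]_(k, m)) :
    B^T = B -> K *m B = 0 -> B != 0 ->
    (forall u : 'cV[R]_m, B *m u = 0 -> K *m u = 0 -> u = 0) ->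
  0 < sigma_min B /\
  (forall u : 'cV[R]_m, K *m u = 0 ->
     sigma_min B ^+ 2 * dotp u u <= dotp (B *m u) (B *m u)).
Proof.
move=> BT KB B0 BK.
have KBu (u : 'cV_m) : K *m (B *m u) = 0 by rewrite mulmxA KB mul0mx.
have [u0 Bu0] : exists u : 'cV_m, B *m u != 0.
  apply: contrapT => /forallNP B0'; move/eqP: B0; apply.
  apply/matrixP => i j; have := B0' (delta_mx j 0).
  rewrite -colE => /negP; rewrite negbK => /eqP/matrixP/(_ i 0).
  by rewrite !mxE.
have KS (u : 'cV[R]_m) : K *m u = 0 -> K *m (B^T *m B *m u) = 0.
  by move=> _; rewrite BT -mulmxA KBu.
have [v [c [Kv v0 Sv cmin]]] := symmetric_min_eigenvector (gram_sym B) KS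
  (ex_intro2 _ _ (B *m u0) (KBu u0) Bu0).
have {}cmin u : K *m u = 0 -> c * dotp u u <= dotp (B *m u) (B *m u).
  by move=> /cmin; rewrite dotp_gram.
have c0 : 0 < c.
  rewrite -(pmulr_lgt0 _ (dotp_gt0 v0)) -dotpZr -Sv dotp_gram dotp_gt0 //.
  by apply/eqP => /BK /(_ Kv) /eqP; rewrite (negbTE v0).
have lbs s : singular_value B s /\ s != 0 -> Num.sqrt c <= s.
  move=> [[s0 /(eigenvalue_colP _ (gram_sym B))[w Sw w0]] sn0].
  rewrite -(ler_pXn2r (n := 2)) ?nnegrE ?sqrtr_ge0 // sqr_sqrtr ?(ltW c0) //.
  have Kw : K *m w = 0.
    have -> : w = (s ^+ 2)^-1 *: (B *m (B *m w)).
      by rewrite -[B in X in X *m _]BT mulmxA Sw scalerA mulVf ?scale1r // expf_neq0.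
    by rewrite -scalemxAr KBu scaler0.
  by rewrite -(ler_pM2r (dotp_gt0 w0)) -(dotpZr (s ^+ 2)) -Sw dotp_gram; exact: cmin.
have sc : singular_value B (Num.sqrt c) /\ Num.sqrt c != 0.
  split; last by rewrite gt_eqF // sqrtr_gt0.
  split; first exact: sqrtr_ge0.
  by rewrite sqr_sqrtr ?(ltW c0) //; apply/(eigenvalue_colP _ (gram_sym B)); exists v.
have -> : sigma_min B = Num.sqrt c.
  apply/eqP; rewrite eq_le; apply/andP; split.
    by apply: ge_inf => //; exists (Num.sqrt c) => s /lbs.
  by apply: lb_le_inf; [exists (Num.sqrt c) | move=> s /lbs].
by rewrite sqrtr_gt0; split => // u /cmin; rewrite sqr_sqrtr // ltW.
Qed.

(** For an eigenvector [u] of the square of [C], the vector [C *m u + s *: u] is either an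
    eigenvector of [C] for [s], and [C < I] gives [s < 1], or zero, and positive semidefiniteness
    forces [s <= 0]. *)
Lemma sigma_max_psd_lt1 (R : realType) m (C : 'M[R]_m) :
    (0 < m)%N -> C^T = C -> psdmx C -> loewner_lt C 1%:M ->
  0 <= sigma_max C < 1.
Proof.
move=> m0 CT C0 C1.
have : const_mx 1 != 0 :> 'cV[R]_m.
  by apply/eqP => /matrixP/(_ (Ordinal m0) 0); rewrite !mxE => /eqP; rewrite oner_eq0.
move=> /(sigma_max_attained C)[s0 [u Cu u0] _]; rewrite s0 /=.
set s := sigma_max C in s0 Cu *; rewrite CT in Cu.
have Cw : C *m (C *m u + s *: u) = s *: (C *m u + s *: u).
  rewrite mulmxDr mulmxA Cu -scalemxAr scalerDr scalerA -expr2 addrC.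
  by [].
have [w0|w0] := eqVneq (C *m u + s *: u) 0.
  have := C0 u; rewrite (_ : C *m u = - (s *: u)) ?dotp_lin; last first.
    by apply/eqP; rewrite -addr_eq0 w0.
  rewrite oppr_ge0 pmulr_lle0 ?dotp_gt0 // => s0'.
  by rewrite (le_lt_trans s0') // ltr01.
have := C1 _ w0; rewrite mulmxBl mul1mx Cw dotpDr dotpNr dotpZr.
by rewrite subr_gt0 gtr_pMl // dotp_gt0.
Qed.

(** Cauchy-Schwarz for the form of [C], applied to [u] and [v = C u], gives
    [|v|^4 <= (u . C u) (v . C v)], and [v . C v <= c |v|^2]. *)
Lemma sqr_le_mul_psd (R : realType) m (C : 'M[R]_m) (c : R) (u : 'cV[R]_m) :
    C^T = C -> psdmx C -> (forall v, dotp (C *m v) (C *m v) <= c ^+ 2 * dotp v v) ->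
  0 <= c -> dotp (C *m u) (C *m u) <= c * dotp u (C *m u).
Proof.
move=> CT C0 Cc c0; set v := C *m u.
have vv : dotp v (C *m v) <= c * dotp v v.
  rewrite -(ler_pXn2r (n := 2)) ?nnegrE ?C0 ?mulr_ge0 ?dotp_ge0 //.
  rewrite (le_trans (cauchy_schwarz _ _)) // exprMn.
  by have := Cc v; have := dotp_ge0 v; nra.
have := @psd_cauchy_schwarz _ _ C u v CT (fun _ => C0 _) (C0 _).
rewrite dotp_mulmxr CT -/v.
have [->|v0] := eqVneq v 0; first by rewrite dotp0l dotp0r mulr0.
have := dotp_gt0 v0; have := C0 u; rewrite -/v; nra.
Qed.

(** * Smoothness, strong convexity and proximal steps *)

Lemma derive_grad (R : realType) m (phi : 'cV[R]_m -> R) x v :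
  differentiable phi x -> 'D_v phi x = dotp (grad phi x) v.
Proof.
move=> dphi; rewrite dotpE.
have -> : v = \sum_i v i 0 *: delta_mx i 0.
  by rewrite [LHS]matrix_sum_delta; apply: eq_bigr => i _; rewrite big_ord1.
rewrite deriveE // linear_sum; apply: eq_bigr => i _.
rewrite linearZ /= -deriveE // mxE mulrC summxE (bigD1 i) //= big1 => [|j ji].
  by rewrite !mxE !eqxx mulr1 addr0.
by rewrite !mxE [_ == j]eq_sym (negbTE ji) mulr0.
Qed.

Lemma is_derive_line (R : realType) m (phi : 'cV[R]_m -> R) x d t :
  differentiable phi (x + t *: d) ->
  is_derive t 1 (fun s => phi (x + s *: d)) (dotp (grad phi (x + t *: d)) d).
Proof.
move=> dphi; rewrite -derive_grad //.
have E : (fun h : R => h^-1 *: (((fun s => phi (x + s *: d)) \o shift t) (h *: 1)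
      - phi (x + t *: d))) =
    (fun h => h^-1 *: ((phi \o shift (x + t *: d)) (h *: d) - phi (x + t *: d))).
  apply/funext => h /=; congr (_ *: (phi _ - _)).
  by rewrite /= scalerDl [h *: 1]mulr1 addrCA.
apply: DeriveDef; last by rewrite /derive E.
by rewrite /derivable E; exact: diff_derivable.
Qed.

(** The mean value theorem, applied to [psi] minus a primitive of the bound, stands in for
    integrating the derivative over [0, 1]. *)
Lemma le_of_derive_le_affine (R : realType) (psi psi' : R -> R) (a b : R) :
    (forall t : R, is_derive t 1 psi (psi' t)) ->
    (forall t, 0 < t -> psi' t <= a + b * t) ->
  psi 1 <= psi 0 + a + b / 2.
Proof.
move=> dpsi lepsi.
pose chi : R -> R := psi - (a \*o id) - ((b / 2) \*o (fun t => t ^+ 2)).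
pose chi' t := psi' t - a - b * t.
have dchi (t : R) : is_derive t 1 chi (chi' t).
  have d := dpsi t.
  by apply: is_derive_eq; rewrite /chi' /GRing.scale /=; field.
have cchi : {within `[0, 1], continuous chi}.
  by apply: continuous_subspaceT => x; apply/differentiable_continuous/derivable1_diffP.
have [c + E] := MVT ltr01 (fun t _ => dchi t) cchi.
rewrite in_itv /= => /andP[/lepsi c0 _]; move: E.
rewrite /chi /chi' /=  subr0 mulr1 !fctE /= !mulr1 expr1n !expr0n /= !mulr0; lra.
Qed.

Lemma lsmooth_descent (R : realType) m (L : R) (phi : 'cV[R]_m -> R) x d :
  lsmooth L phi ->
  `|phi (x + d) - phi x - dotp (grad phi x) d| <= L / 2 * dotp d d.
Proof.
move=> [dphi Lphi].
have dpsi t := is_derive_line (dphi (x + t *: d)).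
have bnd t (w := grad phi (x + t *: d) - grad phi x) : 0 < t ->
    enorm w * enorm d <= L * dotp d d * t.
  move=> t0; have := Lphi (x + t *: d) x; rewrite -/w addrAC subrr add0r.
  rewrite {2}/enorm !dotp_lin mulrA -expr2 sqrtrM ?sqr_ge0 // sqrtr_sqr gtr0_norm //.
  rewrite -/(enorm d) -sqr_enorm => /(ler_wpM2r (enorm_ge0 d)) /le_trans -> //.
  by rewrite le_eqVlt; apply/orP; left; apply/eqP; ring.
have up := @le_of_derive_le_affine R _ _ (dotp (grad phi x) d) (L * dotp d d) dpsi.
have lo := @le_of_derive_le_affine R (fun s => - phi (x + s *: d)) _
  (- dotp (grad phi x) d) (L * dotp d d) (fun t => is_deriveN (dpsi t)).
rewrite scale1r scale0r addr0 in up lo.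
rewrite ler_norml; apply/andP; split.
  have : - phi (x + d) <= - phi x + - dotp (grad phi x) d + L * dotp d d / 2; last by lra.
  apply: lo => t t0; have := bnd t t0.
  have := dotp_le_enorm (- (grad phi (x + t *: d) - grad phi x)) d.
  rewrite [enorm (- _)](_ : _ = enorm (grad phi (x + t *: d) - grad phi x)).
    by rewrite !dotp_lin; lra.
  by rewrite /enorm dotpNl dotpNr opprK.
have : phi (x + d) <= phi x + dotp (grad phi x) d + L * dotp d d / 2; last by lra.
apply: up => t t0; have := bnd t t0.
by have := dotp_le_enorm (grad phi (x + t *: d) - grad phi x) d; rewrite !dotp_lin; lra.
Qed.

(** Division by [t] followed by [t -> 0]; the first-order conditions below are extracted this
    way. *)
Lemma le0_of_mul_le_sqr (R : realType) (c K : R) :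
  (forall t, 0 < t <= 1 -> t * c <= t ^+ 2 * K) -> c <= 0.
Proof.
move=> cK; rewrite leNgt; apply/negP => c0.
have cK1 : c <= K by have := cK 1; rewrite ltr01 lexx => /(_ isT); lra.
have K0 : 0 < K by lra.
(* At this [t] the left side is twice the right side. *)
have := cK (c / (2 * K)); have -> : c / (2 * K) * c = (c / (2 * K)) ^+ 2 * K * 2.
  by field; rewrite gt_eqF.
have : 0 < (c / (2 * K)) ^+ 2 * K by rewrite mulr_gt0 // exprn_gt0 // divr_gt0 // mulr_gt0.
have -> : 0 < c / (2 * K) <= 1.
  by rewrite divr_gt0 ?mulr_gt0 // ler_pdivrMr ?mulr_gt0 // mul1r; lra.
by move=> ? /(_ isT); lra.
Qed.

Lemma strongly_convex_gradient (R : realType) m (L mu : R) (phi : 'cV[R]_m -> R) x d :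
  lsmooth L phi -> strongly_convex mu phi ->
  phi x + dotp (grad phi x) d + mu / 2 * dotp d d <= phi (x + d).
Proof.
move=> Lphi cphi; rewrite -subr_le0.
apply: (@le0_of_mul_le_sqr _ _ (L / 2 * dotp d d + mu / 2 * dotp d d)) => t /andP[t0 t1].
have := cphi (x + d) x t; rewrite (ltW t0) t1 => /(_ isT).
have -> : t *: (x + d) + (1 - t) *: x = x + t *: d.
  by rewrite scalerDr scalerBl scale1r addrC addrA subrK.
rewrite (_ : x + d - x = d) ?sqr_enorm; last by rewrite addrAC subrr add0r.
have := lsmooth_descent x (t *: d) Lphi; rewrite ler_norml => /andP[+ _].
rewrite !dotp_lin; nra.
Qed.

(* Only finite values are constrained, so that no [+oo - +oo] can arise. *)
Definition strongly_econvex (R : realType) m (mu : R) (phi : 'cV[R]_m -> \bar R) :=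
  forall x y t a b, 0 <= t <= 1 -> phi x = a%:E -> phi y = b%:E ->
    (phi (t *: x + (1 - t)%R *: y)%R <=
     (t * a + (1 - t) * b - mu / 2 * t * (1 - t) * dotp (x - y) (x - y))%:E)%E.

Lemma econvex_strongly (R : realType) m (phi : 'cV[R]_m -> \bar R) :
  econvex phi -> strongly_econvex 0 phi.
Proof.
move=> cphi x y t a b t01 xa yb; have := cphi x y t t01.
by rewrite xa yb !mul0r subr0.
Qed.

(** [s] plays the directional derivative of [F] along [d], known up to a quadratic remainder. The
    minimizer is compared with [x + t *: d] for small [t]. Proximal steps and both halves of the
    saddle point condition are instances. *)
Lemma argmin_subgradient (R : realType) m (mu : R) (phi : 'cV[R]_m -> \bar R)
    (F : 'cV[R]_m -> R) x d a s K :
    strongly_econvex mu phi -> phi x = a%:E ->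
    (forall z, (phi x + (F x)%:E <= phi z + (F z)%:E)%E) ->
    (forall t, 0 < t <= 1 -> F (x + t *: d) <= F x + t * s + t ^+ 2 * K) ->
  ((a - s + mu / 2 * dotp d d)%:E <= phi (x + d)%R)%E.
Proof.
move=> cphi xa xmin Fs.
case xd : (phi (x + d)) => [b||]; [|by rewrite leey|]; last first.
  by have := xmin (x + d); rewrite xd xa.
rewrite lee_fin -subr_le0.
apply: (@le0_of_mul_le_sqr _ _ (K + mu / 2 * dotp d d)) => t /andP[t0 t1].
have := cphi _ _ t _ _ _ xd xa; rewrite (ltW t0) t1 => /(_ isT).
have -> : t *: (x + d) + (1 - t) *: x = x + t *: d.
  by rewrite scalerDr scalerBl scale1r addrC addrA subrK.
have -> : x + d - x = d by rewrite addrAC subrr add0r.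
move=> /(leeD2r (F (x + t *: d))%:E) /(le_trans (xmin _)).
rewrite xa -!EFinD lee_fin.
by have := Fs t; rewrite t0 t1 => /(_ isT); nra.
Qed.

Lemma prox_subgradient (R : realType) m (mu al b : R) (phi : 'cV[R]_m -> \bar R) x y z :
    0 < al -> strongly_econvex mu phi -> is_prox al phi x y -> phi y = b%:E ->
  ((b + al^-1 * dotp (x - y) (z - y) + mu / 2 * dotp (z - y) (z - y))%:E <= phi z)%E.
Proof.
move=> al0 cphi pxy yb.
pose F (w : 'cV[R]_m) := (2 * al)^-1 * enorm (w - x) ^+ 2.
have /(_ (z - y)) := @argmin_subgradient _ _ mu phi F y _ b (al^-1 * dotp (y - x) (z - y))
  ((2 * al)^-1 * dotp (z - y) (z - y)) cphi yb pxy.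
rewrite subrKC => H; apply: le_trans (H _); last first.
  move=> t _; rewrite /F !sqr_enorm; move: (z - y) => d.
  have -> : y + t *: d - x = (y - x) + t *: d by rewrite addrAC.
  move: (y - x) => e; rewrite !dotp_lin (dotpC d e) le_eqVlt; apply/orP; left.
  by apply/eqP; field; rewrite gt_eqF.
by rewrite lee_fin -opprB dotpNl; lra.
Qed.

Lemma prox_finite (R : realType) m (al : R) (phi : 'cV[R]_m -> \bar R) x y :
  eproper phi -> is_prox al phi x y -> exists b, phi y = b%:E.
Proof.
move=> [phiN [z phiz]] /(_ z); have := phiN y; have := phiN z.
case: (phi z) phiz => // c _ _; by case: (phi y) => [b||] // _; exists b.
Qed.

(** * Fenchel conjugates of smooth functions *)

Lemma conjugate_ge (R : realType) m (h : 'cV[R]_m -> \bar R) z x :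
  ((dotp z x)%:E - h x <= conjugate h z)%E.
Proof. by apply: ereal_sup_ubound; exists x. Qed.

(* The supremum at [t *: u + (1 - t) *: v] is tested at [z], those at [u] and [v] at
   [z + (1 - t) *: w] and [z - t *: w]; the choice of [w] optimizes the resulting gain. *)
Lemma conjugate_strongly_econvex (R : realType) m (L : R) (h : 'cV[R]_m -> \bar R) :
  0 < L -> elsmooth L h -> strongly_econvex L^-1 (conjugate h).
Proof.
move=> L0 [hfin hL] u v t a b /andP[t0 t1] ua vb.
apply: ge_ereal_sup => _ [z _ <-].
set w := L^-1 *: (u - v).
have hr x : h x = (fine (h x))%:E by rewrite fineK.
have := conjugate_ge h u (z + (1 - t) *: w); rewrite ua hr -EFinB lee_fin => le1.
have := conjugate_ge h v (z + (- t) *: w); rewrite vb hr -EFinB lee_fin => le2.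
rewrite hr -EFinB lee_fin.
have := lsmooth_descent z ((1 - t) *: w) hL; have := lsmooth_descent z ((- t) *: w) hL.
rewrite !ler_norml => /andP[_] /= le3 /andP[_] /= le4.
have uw : u - v = L *: w by rewrite /w scalerA mulfV ?scale1r // gt_eqF.
move: w uw le1 le2 le3 le4 => w uw; rewrite uw.
have -> : u = v + L *: w by rewrite -uw subrKC.
move: (fine (h z)) (fine (h (z + _))) (fine (h (z + _))) => r r1 r2.
rewrite !dotp_lin => le1 le2 le3 le4.
have {}le1 := ler_wpM2l t0 (lerD le1 le4).
have t1' : 0 <= 1 - t by lra.
have {}le2 := ler_wpM2l t1' (lerD le2 le3).
have -> : L^-1 / 2 * t * (1 - t) * (L * (L * dotp w w)) = L / 2 * t * (1 - t) * dotp w w.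
  by field; rewrite gt_eqF.
have := lerD le1 le2; lra.
Qed.

Lemma conjugate_neqNy (R : realType) m (h : 'cV[R]_m -> \bar R) z :
  (forall x, h x \is a fin_num) -> conjugate h z != -oo%E.
Proof.
move=> hfin; have := conjugate_ge h z 0; rewrite -(fineK (hfin _)) -EFinB.
by case: (conjugate h z).
Qed.

(** The gradient inequality of the convex [h] shows that the supremum is attained at [s]. This
    supplies points where the conjugate is finite. *)
Lemma conjugate_grad (R : realType) m (L : R) (h : 'cV[R]_m -> \bar R) s :
    econvex h -> elsmooth L h ->
  let z := grad (fine \o h) s in
  conjugate h z = (dotp z s - fine (h s))%:E.
Proof.
move=> ch [hfin hL] z.
have hr x : h x = (fine (h x))%:E by rewrite fineK.
apply/eqP; rewrite eq_le; apply/andP; split; last first.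
  by have := conjugate_ge h z s; rewrite (hr s).
apply: ge_ereal_sup => _ [x _ <-]; rewrite hr -EFinB lee_fin.
have cf : strongly_convex 0 (fine \o h).
  move=> u v t t01; have := ch u v t t01.
  by rewrite (hr u) (hr v) (hr (_ + _)) lee_fin /=; lra.
have := strongly_convex_gradient s (x - s) hL cf; rewrite subrKC /= -/z !dotp_lin; lra.
Qed.

(** * Block-separable sums and their gradients *)

Lemma submxcolZ (R : realType) n (d : 'I_n -> nat) (a : R) (x : 'cV[R]_(\sum_i d i)) i :
  submxcol (a *: x) i = a *: submxcol x i.
Proof. by apply/matrixP => j k; rewrite !mxE. Qed.

Lemma dotp_blocks (R : realType) n (d : 'I_n -> nat) (u v : 'cV[R]_(\sum_i d i)) :
  dotp u v = \sum_i dotp (submxcol u i) (submxcol v i).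
Proof.
rewrite /dotp -[u in LHS]submxcolK -[v in LHS]submxcolK tr_mxcol mul_mxrow_mxcol.
by rewrite summxE.
Qed.

Lemma esum_EFin (R : realType) n (F : 'I_n -> \bar R) a :
  (forall i, F i != -oo%E) -> (\sum_i F i)%E = a%:E ->
  (forall i, F i = (fine (F i))%:E) /\ a = \sum_i fine (F i).
Proof.
move=> FN Fa.
have Ffin i : F i = (fine (F i))%:E.
  rewrite fineK // fin_numE FN /=; apply/eqP => Fi.
  move/eqP: Fa; rewrite (bigD1 i) //= Fi addye //; apply/eqP => /esum_eqNyP[j [_ _ /eqP]].
  by rewrite (negbTE (FN j)).
split => //; apply: EFin_inj; rewrite -Fa -sumEFin.
by apply: eq_bigr => i _; rewrite -Ffin.
Qed.

Lemma esepsum_strongly_econvex (R : realType) n (d : 'I_n -> nat) (mu : R)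
    (g : forall i, 'cV[R]_(d i) -> \bar R) :
    (forall i x, g i x != -oo%E) -> (forall i, strongly_econvex mu (g i)) ->
  strongly_econvex mu (esepsum g).
Proof.
move=> gN cg x y t a b t01 /esum_EFin[//|xa ->] /esum_EFin[//|yb ->].
rewrite !mulr_sumr dotp_blocks mulr_sumr -big_split -sumrB -sumEFin.
apply: lee_sum => i _; rewrite submxcolD !submxcolZ submxcolB.
exact: cg.
Qed.

Lemma esepsum_proper (R : realType) n (d : 'I_n -> nat)
    (g : forall i, 'cV[R]_(d i) -> \bar R) :
  (forall i, eproper (g i)) -> eproper (esepsum g).
Proof.
move=> pg; split => [x|].
  apply/eqP => /esum_eqNyP[i [_ _ /eqP]].
  by rewrite (negbTE ((pg i).1 _)).
pose z i := projT1 (cid (pg i).2).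
exists (\mxcol_i z i); apply/eqP => /esum_eqyP.
have gN i : g i (submxcol (\mxcol_i z i) i) != -oo%E by exact: (pg i).1.
case=> [i _ //|i [_ _ /eqP]]; rewrite mxcolK.
by rewrite (negbTE (projT2 (cid (pg i).2))).
Qed.

Lemma scale_strongly_econvex (R : realType) m (c mu : R) (phi : 'cV[R]_m -> \bar R) :
  0 < c -> strongly_econvex mu phi ->
  strongly_econvex (c * mu) (fun x => c%:E * phi x)%E.
Proof.
move=> c0 cphi x y t a b t01.
have fin z r : (c%:E * phi z = r%:E -> phi z = (r / c)%:E)%E.
  case: (phi z) => [s||]; rewrite ?gt0_muleNy ?gt0_muley ?lte_fin // -EFinM.
  by move=> [<-]; rewrite mulrC mulKf // gt_eqF.
move=> /fin xa /fin yb.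
have := cphi _ _ _ _ _ t01 xa yb.
rewrite -(@lee_pmul2l _ c%:E) ?lte_fin // -EFinM => /le_trans -> //.
by rewrite lee_fin le_eqVlt; apply/orP; left; apply/eqP; field; rewrite gt_eqF.
Qed.

(** The weight [1/n] divides the modulus [1/L] of each conjugate; the contraction factor
    [1 + beta / (n%:R * L)] originates here. *)
Lemma hbar_strongly_econvex (R : realType) n p (L : R) (h : 'cV[R]_p -> \bar R) :
  (0 < n)%N -> 0 < L -> elsmooth L h -> strongly_econvex (n%:R * L)^-1 (@hbar R n p h).
Proof.
move=> n0 L0 hL; rewrite invfM.
apply: (@scale_strongly_econvex _ _ _ _ (@esepsum R n (fun=> p) (fun=> conjugate h))).
  by rewrite invr_gt0 ltr0n.
apply: esepsum_strongly_econvex => i; last exact: conjugate_strongly_econvex.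
by move=> x; apply: conjugate_neqNy; exact: hL.1.
Qed.

(** The Kronecker product of the all-ones vector with [u]: a consensus vector. *)
Definition repcol (R : realType) n p (u : 'cV[R]_p) : 'cV[R]_(\sum_(i < n) p) :=
  \mxcol_(i < n) u.

Lemma hbar_repcol (R : realType) n p (h : 'cV[R]_p -> \bar R) u a :
  (0 < n)%N -> conjugate h u = a%:E -> hbar h (@repcol R n p u) = a%:E.
Proof.
move=> n0 ua; rewrite /hbar /repcol.
under eq_bigr => i _ do rewrite mxcolK ua.
rewrite sumEFin sumr_const card_ord -EFinM -[a *+ n]mulr_natl mulKf //.
by rewrite pnatr_eq0 -lt0n.
Qed.

Lemma hbar_proper (R : realType) n p (h : 'cV[R]_p -> \bar R) u a :
  (0 < n)%N -> (forall x, h x \is a fin_num) -> conjugate h u = a%:E ->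
  eproper (@hbar R n p h).
Proof.
move=> n0 hfin ua; split => [x|]; last first.
  by exists (repcol n u); rewrite (hbar_repcol n0 ua).
have n1 : (0%:E < (n%:R^-1 : R)%:E)%E by rewrite lte_fin invr_gt0 ltr0n.
have : (\sum_(i < n) conjugate h (submxcol x i) != -oo)%E.
  apply/eqP => /esum_eqNyP[i [_ _ /eqP]].
  by rewrite (negbTE (conjugate_neqNy _ hfin)).
rewrite /hbar; case: (\sum_i _)%E => // _.
by rewrite gt0_muley.
Qed.

(** The difference quotient along [v] is literally that of [phi] along the block of [v]. *)
Lemma is_derive_block (R : realType) n (d : 'I_n -> nat) i (phi : 'cV[R]_(d i) -> R)
    (x v : 'cV[R]_(\sum_i d i)) :
  differentiable phi (submxcol x i) ->
  is_derive x v (fun z => phi (submxcol z i))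
    (dotp (grad phi (submxcol x i)) (submxcol v i)).
Proof.
move=> dphi; rewrite -derive_grad //.
have E : (fun h : R => h^-1 *: (((fun z => phi (submxcol z i)) \o shift x) (h *: v)
      - phi (submxcol x i))) =
    (fun h => h^-1 *: ((phi \o shift (submxcol x i)) (h *: submxcol v i)
      - phi (submxcol x i))).
  by apply/funext => h /=; rewrite submxcolD submxcolZ.
apply: DeriveDef; last by rewrite /derive E.
by rewrite /derivable E; exact: diff_derivable.
Qed.

Lemma grad_sepsum (R : realType) n (d : 'I_n -> nat) (f : forall i, 'cV[R]_(d i) -> R)
    (x : 'cV[R]_(\sum_i d i)) :
  (forall i x, differentiable (f i) x) ->
  grad (sepsum f) x = \mxcol_i grad (f i) (submxcol x i).
Proof.
move=> df; set w := mxcol _; apply/matrixP => k j; rewrite [j]ord1 mxE.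
set v := delta_mx k 0.
have dsum := is_derive_sum (fun i => is_derive_block v (df i (submxcol x i))).
have -> : sepsum f = \sum_i (fun z : 'cV_(\sum_i d i) => f i (submxcol z i)).
  by apply/funext => z; rewrite fct_sumE.
rewrite derive_val; transitivity (dotp w v).
  by rewrite dotp_blocks; apply: eq_bigr => i _; rewrite mxcolK.
rewrite dotpE (bigD1 k) //= [X in _ + X]big1 => [|i ik]; first by rewrite /v [delta_mx _ _ _ _]mxE !eqxx mulr1 addr0.
by rewrite /v [delta_mx _ _ _ _]mxE (negbTE ik) mulr0.
Qed.

Lemma dotp_grad_sepsum (R : realType) n (d : 'I_n -> nat)
    (f : forall i, 'cV[R]_(d i) -> R) (x v : 'cV[R]_(\sum_i d i)) :
  (forall i x, differentiable (f i) x) ->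
  dotp (grad (sepsum f) x) v = \sum_i dotp (grad (f i) (submxcol x i)) (submxcol v i).
Proof.
move=> df; rewrite grad_sepsum // dotp_blocks.
by apply: eq_bigr => i _; rewrite mxcolK.
Qed.

Lemma sepsum_descent (R : realType) n (d : 'I_n -> nat) (l_ : 'I_n -> R) (l : R)
    (f : forall i, 'cV[R]_(d i) -> R) (x v : 'cV[R]_(\sum_i d i)) :
  (forall i, lsmooth (l_ i) (f i)) -> (forall i, l_ i <= l) ->
  sepsum f (x + v) <= sepsum f x + dotp (grad (sepsum f) x) v + l / 2 * dotp v v.
Proof.
move=> fl ll; rewrite dotp_grad_sepsum => [|i]; last exact: (fl i).1.
rewrite dotp_blocks mulr_sumr -!big_split; apply: ler_sum => i _.
rewrite submxcolD; have := lsmooth_descent (submxcol x i) (submxcol v i) (fl i).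
rewrite ler_norml => /andP[_]; rewrite /=.
have := dotp_ge0 (submxcol v i); have := ll i; nra.
Qed.

Lemma sepsum_strongly_convex_gradient (R : realType) n (d : 'I_n -> nat)
    (l_ mu_ : 'I_n -> R) (mu : R)
    (f : forall i, 'cV[R]_(d i) -> R) (x v : 'cV[R]_(\sum_i d i)) :
  (forall i, lsmooth (l_ i) (f i)) -> (forall i, strongly_convex (mu_ i) (f i)) ->
  (forall i, mu <= mu_ i) ->
  sepsum f x + dotp (grad (sepsum f) x) v + mu / 2 * dotp v v <= sepsum f (x + v).
Proof.
move=> fl fc mumu; rewrite dotp_grad_sepsum => [|i]; last exact: (fl i).1.
rewrite dotp_blocks mulr_sumr -!big_split; apply: ler_sum => i _.
rewrite submxcolD.
have := strongly_convex_gradient (submxcol x i) (submxcol v i) (fl i) (fc i).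
by rewrite /=; have := dotp_ge0 (submxcol v i); have := mumu i; nra.
Qed.

Lemma sepsum_gradient_lipschitz (R : realType) n (d : 'I_n -> nat) (l_ : 'I_n -> R)
    (l : R) (f : forall i, 'cV[R]_(d i) -> R) (x y : 'cV[R]_(\sum_i d i))
    (w := grad (sepsum f) x - grad (sepsum f) y) :
  (forall i, lsmooth (l_ i) (f i)) -> (forall i, 0 <= l_ i <= l) ->
  dotp w w <= l ^+ 2 * dotp (x - y) (x - y).
Proof.
move=> fl ll; rewrite !dotp_blocks mulr_sumr; apply: ler_sum => i _.
rewrite /w !grad_sepsum => [|j|j]; try exact: (fl j).1.
rewrite !submxcolB !mxcolK -!sqr_enorm -exprMn.
have /andP[l0 lli] := ll i.
rewrite ler_pXn2r ?nnegrE ?mulr_ge0 ?enorm_ge0 //; last exact: le_trans lli.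
by rewrite (le_trans ((fl i).2 _ _)) // ler_wpM2r ?enorm_ge0.
Qed.

(** * Kronecker products and consensus *)

Lemma submxcol_kronI (R : realType) n p (M : 'M[R]_n) (u : 'cV[R]_(\sum_(i < n) p)) i :
  submxcol (kronI p M *m u) i = \sum_j M i j *: submxcol u j.
Proof.
rewrite -[u in LHS]submxcolK /kronI mul_mxblock_mxrow mxcolK.
by apply: eq_bigr => j _; rewrite mul_scalar_mx.
Qed.

Lemma tr_kronI (R : realType) n p (M : 'M[R]_n) : (kronI p M)^T = kronI p M^T.
Proof.
rewrite /kronI tr_mxblock; apply/eq_mxblockP => i j.
by rewrite tr_scalar_mx mxE.
Qed.

(** Coordinate [k] of every agent. On such a slice [kronI p M] acts as [M], which reduces statements
    about stacked vectors to vectors with one entry per agent. *)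
Definition slice (R : realType) n p (k : 'I_p) (u : 'cV[R]_(\sum_(i < n) p)) : 'cV[R]_n :=
  \col_i submxcol u i k 0.

Lemma slice_kronI (R : realType) n p k (M : 'M[R]_n) (u : 'cV[R]_(\sum_(i < n) p)) :
  slice k (kronI p M *m u) = M *m slice k u.
Proof.
apply/matrixP => i j; rewrite [j]ord1 [LHS]mxE submxcol_kronI summxE [RHS]mxE.
by apply: eq_bigr => a _; rewrite [LHS]mxE [slice _ _ _ _]mxE.
Qed.

Lemma slice_inj (R : realType) n p (u v : 'cV[R]_(\sum_(i < n) p)) :
  (forall k, slice k u = slice k v) -> u = v.
Proof.
move=> uv; apply/mxcolP => i; apply/matrixP => k j; rewrite [j]ord1.
by have /matrixP/(_ i 0) := uv k; rewrite mxE [in RHS]mxE.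
Qed.

Lemma dotp_slice (R : realType) n p (u v : 'cV[R]_(\sum_(i < n) p)) :
  dotp u v = \sum_k dotp (slice k u) (slice k v).
Proof.
rewrite dotp_blocks.
under eq_bigr do rewrite dotpE; under [RHS]eq_bigr do rewrite dotpE.
rewrite exchange_big; apply: eq_bigr => k _; apply: eq_bigr => i _.
by rewrite [slice k u i 0]mxE [slice k v i 0]mxE.
Qed.

Lemma kronI_norm_le (R : realType) n p (M : 'M[R]_n) c (u : 'cV[R]_(\sum_(i < n) p)) :
  (forall v, dotp (M *m v) (M *m v) <= c * dotp v v) ->
  dotp (kronI p M *m u) (kronI p M *m u) <= c * dotp u u.
Proof.
move=> Mc; rewrite !dotp_slice mulr_sumr; apply: ler_sum => k _.
by rewrite slice_kronI.
Qed.

Lemma psdmx_kronI (R : realType) n p (M : 'M[R]_n) : psdmx M -> psdmx (kronI p M).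
Proof.
by move=> M0 u; rewrite dotp_slice; apply: sumr_ge0 => k _; rewrite slice_kronI.
Qed.

(** The all-ones row tensored with the identity, transpose to [repcol]; its kernel is the orthogonal
    complement of the consensus vectors. *)
Definition sumcol (R : realType) n p : 'M[R]_(p, \sum_(i < n) p) := \mxrow_(i < n) 1%:M.

Lemma sumcolE (R : realType) n p (u : 'cV[R]_(\sum_(i < n) p)) :
  sumcol R n p *m u = \sum_i submxcol u i.
Proof.
rewrite -[u in LHS]submxcolK mul_mxrow_mxcol.
by apply: eq_bigr => i _; rewrite mul1mx.
Qed.

Lemma sumcol_slice (R : realType) n p (u : 'cV[R]_(\sum_(i < n) p)) :
  sumcol R n p *m u = 0 <-> forall k, (const_mx 1 : 'rV_n) *m slice k u = 0.
Proof.
have E k : ((const_mx 1 : 'rV_n) *m slice k u) 0 0 = (sumcol R n p *m u) k 0.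
  rewrite sumcolE summxE mxE; apply: eq_bigr => i _.
  by rewrite [const_mx _ _ _]mxE [slice _ _ _ _]mxE mul1r.
split=> [u0 k|u0]; apply/matrixP => i j; first by rewrite !ord1 E u0 !mxE.
by rewrite [j]ord1 -E u0 !mxE.
Qed.

Lemma repcolE (R : realType) n p (u : 'cV[R]_p) : repcol n u = (sumcol R n p)^T *m u.
Proof.
rewrite /sumcol tr_mxrow mxcol_mul /repcol; apply/eq_mxcolP => i.
by rewrite trmx1 mul1mx.
Qed.

Lemma dotp_repcol (R : realType) n p (u : 'cV[R]_p) (v : 'cV[R]_(\sum_(i < n) p)) :
  dotp (repcol n u) v = dotp u (sumcol R n p *m v).
Proof. by rewrite repcolE dotp_mulmxr. Qed.

Lemma kronI_repcol (R : realType) n p (M : 'M[R]_n) (a : R) (u : 'cV[R]_p) :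
  M *m (const_mx 1 : 'cV_n) = const_mx a -> kronI p M *m repcol n u = repcol n (a *: u).
Proof.
move=> M1; apply: slice_inj => k; rewrite slice_kronI.
have E (w : 'cV[R]_p) : slice k (repcol n w) = w k 0 *: (const_mx 1 : 'cV_n).
  by apply/matrixP => i j; rewrite [LHS]mxE mxcolK !mxE mulr1.
rewrite !E -scalemxAr M1; apply/matrixP => i j; rewrite !mxE.
by rewrite mulr1 mulrC.
Qed.

Lemma blockdiag_mulmx (R : realType) n p (d : 'I_n -> nat) (A : forall i, 'M[R]_(p, d i))
    (x : 'cV[R]_(\sum_i d i)) :
  sumcol R n p *m (blockdiag A *m x) = (\mxrow_i A i) *m x.
Proof.
rewrite mulmxA /sumcol mul_mxrow_mxblock; congr (_ *m _); apply/eq_mxrowP => j.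
rewrite (bigD1 j) //= eqxx mul1mx big1 ?addr0 // => i ij.
by rewrite (negbTE ij) mulmx0.
Qed.

(** Jensen: each row of [D] is a family of weights, whose variance is nonnegative; unit column sums
    then recover [dotp v v]. *)
Lemma doubly_stochastic_norm_le (R : realType) n (D : 'M[R]_n) (v : 'cV[R]_n) :
  doubly_stochastic D -> dotp (D *m v) (D *m v) <= dotp v v.
Proof.
move=> [D0 Dr Dc]; rewrite !dotpE.
have -> : \sum_j v j 0 * v j 0 = \sum_i \sum_j D i j * (v j 0) ^+ 2.
  rewrite exchange_big; apply: eq_bigr => j _.
  by rewrite -mulr_suml Dc mul1r expr2.
apply: ler_sum => i _; rewrite mxE.
have E m : \sum_j D i j * (v j 0 - m) ^+ 2 =
    \sum_j D i j * v j 0 ^+ 2 - 2 * m * (\sum_j D i j * v j 0) + m ^+ 2 * \sum_j D i j.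
  rewrite !mulr_sumr -sumrB -big_split; apply: eq_bigr => j _ /=; ring.
have : 0 <= \sum_j D i j * (v j 0 - \sum_k D i k * v k 0) ^+ 2.
  by apply: sumr_ge0 => j _; rewrite mulr_ge0 ?sqr_ge0.
rewrite {}E Dr; lra.
Qed.

(** * Kernel and range of a matrix whose kernel is the consensus line *)

Lemma null_is_span1_kernel (R : realType) n (B : 'M[R]_n) (u : 'cV[R]_n) :
  null_is_span1 B -> B *m u = 0 -> exists a, u = const_mx a.
Proof.
move=> nB Bu; have : [set u | B *m u = 0] u by [].
rewrite nB => -[a _ <-]; exists a; apply/matrixP => i j.
by rewrite !mxE mulr1.
Qed.

Lemma null_is_span1_mul1 (R : realType) n (B : 'M[R]_n) :
  null_is_span1 B -> B *m (const_mx 1 : 'cV_n) = 0.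
Proof.
move=> nB; have : range (fun a : R => a *: (const_mx 1 : 'cV[R]_n)) (const_mx 1).
  by exists 1; rewrite ?scale1r.
by rewrite -nB.
Qed.

(** The range of a symmetric matrix is the orthogonal complement of its kernel: the columns of
    [cokermx B] lie in the kernel of [B], hence are constant and orthogonal to [w]. *)
Lemma null_is_span1_range (R : realType) n (B : 'M[R]_n) (w : 'cV[R]_n) :
    (0 < n)%N -> B^T = B -> null_is_span1 B -> (const_mx 1 : 'rV_n) *m w = 0 ->
  exists z, B *m z = w /\ (const_mx 1 : 'rV_n) *m z = 0.
Proof.
move=> n0 BT nB w0.
have : (w^T <= B)%MS.
  rewrite submxE; apply/eqP/matrixP => i j; rewrite [RHS]mxE.
  have : B *m col j (cokermx B) = 0 by rewrite colE mulmxA mulmx_coker mul0mx.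
  move=> /(null_is_span1_kernel nB)[a ca].
  have -> : (w^T *m cokermx B) i j = (w^T *m col j (cokermx B)) i 0.
    by rewrite [LHS]mxE [RHS]mxE; apply: eq_bigr => k _; rewrite [col _ _ _ _]mxE.
  rewrite ca; have -> : const_mx a = a *: (const_mx 1 : 'rV[R]_n)^T.
    by apply/matrixP => ? ?; rewrite !mxE mulr1.
  by rewrite -scalemxAr -trmx_mul w0 trmx0 scaler0 mxE.
move=> /submxP[z0 wz].
have Bz : B *m z0^T = w by rewrite -[w]trmxK wz trmx_mul BT.
(* The mean of [z0]; subtracting it preserves the image under [B] and makes the sum zero. *)
pose c := ((const_mx 1 : 'rV[R]_n) *m z0^T) 0 0 / n%:R.
exists (z0^T - c *: const_mx 1); split.
  by rewrite mulmxBr Bz -scalemxAr null_is_span1_mul1 // scaler0 subr0.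
rewrite mulmxBr -scalemxAr; apply/matrixP => i j; rewrite !ord1 [LHS]mxE.
rewrite [X in _ + X]mxE [X in _ - X]mxE.
rewrite [X in _ * X]mxE (eq_bigr (fun=> 1)) => [|k _]; last by rewrite !mxE mulr1.
by rewrite sumr_const card_ord divfK ?subrr ?mxE // pnatr_eq0 -lt0n.
Qed.

Lemma kronI_range (R : realType) n p (B : 'M[R]_n) (w : 'cV[R]_(\sum_(i < n) p)) :
    (0 < n)%N -> B^T = B -> null_is_span1 B -> sumcol R n p *m w = 0 ->
  exists z, kronI p B *m z = w /\ sumcol R n p *m z = 0.
Proof.
move=> n0 BT nB /sumcol_slice w0.
have /choice[z Bz] k := null_is_span1_range n0 BT nB (w0 k).
pose y : 'cV[R]_(\sum_(i < n) p) := \mxcol_(i < n) \col_k z k i 0.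
have yz k : slice k y = z k.
  by apply/matrixP => i j; rewrite [j]ord1 mxE /y mxcolK mxE.
exists y; split; last by apply/sumcol_slice => k; rewrite yz (Bz k).2.
by apply: slice_inj => k; rewrite slice_kronI yz (Bz k).1.
Qed.

Lemma sumcol_kronI (R : realType) n p (B : 'M[R]_n) (w : 'cV[R]_(\sum_(i < n) p)) :
  B^T = B -> null_is_span1 B -> sumcol R n p *m (kronI p B *m w) = 0.
Proof.
move=> BT nB; apply/sumcol_slice => k; rewrite slice_kronI mulmxA.
have -> : (const_mx 1 : 'rV_n) *m B = 0.
  by rewrite -[B]BT -[const_mx 1]trmxK -trmx_mul trmx_const null_is_span1_mul1 // trmx0.
by rewrite mul0mx.
Qed.

Lemma sigma_min_kronI (R : realType) n p (B : 'M[R]_n) :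
    (0 < n)%N -> B^T = B -> null_is_span1 B -> B != 0 ->
  0 < sigma_min B /\
  forall u, sumcol R n p *m u = 0 ->
    sigma_min B ^+ 2 * dotp u u <= dotp (kronI p B *m u) (kronI p B *m u).
Proof.
move=> n0 BT nB B0.
have KB : (const_mx 1 : 'rV_n) *m B = 0.
  by rewrite -[B]BT -[const_mx 1]trmxK -trmx_mul trmx_const null_is_span1_mul1 // trmx0.
have [u /(null_is_span1_kernel nB)[a ->]|s0 sB] := sigma_min_bound BT KB B0.
  move=> /matrixP/(_ 0 0); rewrite !mxE (eq_bigr (fun=> a)) => [|k _].
    rewrite sumr_const card_ord => /eqP; rewrite mulrn_eq0 eqn0Ngt n0 /= => /eqP ->.
    by apply/matrixP => ? ?; rewrite !mxE.
  by rewrite !mxE mul1r.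
split => // u /sumcol_slice u0; rewrite !dotp_slice mulr_sumr.
by apply: ler_sum => k _; rewrite slice_kronI sB.
Qed.

(** * Optimality conditions at the solution *)

Lemma mxrow_mulmx (R : realType) n p (d : 'I_n -> nat) (A : forall i, 'M[R]_(p, d i))
    (x : 'cV[R]_(\sum_i d i)) :
  (\mxrow_i A i) *m x = \sum_i A i *m submxcol x i.
Proof. by rewrite -[x in LHS]submxcolK mul_mxrow_mxcol. Qed.

Lemma objectiveE (R : realType) n p (d : 'I_n -> nat)
    (f : forall i, 'cV[R]_(d i) -> R) (g : forall i, 'cV[R]_(d i) -> \bar R)
    (h : 'cV[R]_p -> \bar R) (A : forall i, 'M[R]_(p, d i)) x :
  objective f g h A x =
  ((sepsum f x)%:E + esepsum g x + h ((\mxrow_i A i) *m x)%R)%E.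
Proof. by rewrite /objective big_split /= sumEFin mxrow_mulmx. Qed.

(** The saddle value is compared with the values at a multiplier with finite conjugate and at a
    point with finite [g]. The first test rules out an infinite conjugate, the second an infinite
    [g]. *)
Lemma saddle_finite (R : realType) n p (d : 'I_n -> nat)
    (f : forall i, 'cV[R]_(d i) -> R) (g : forall i, 'cV[R]_(d i) -> \bar R)
    (h : 'cV[R]_p -> \bar R) (A : forall i, 'M[R]_(p, d i)) (L : R) xbar lbar :
    (forall i, eproper (g i)) -> econvex h -> elsmooth L h ->
    saddle_point (lagrangian f g h A) xbar lbar ->
  exists a b, conjugate h lbar = a%:E /\ esepsum g xbar = b%:E.
Proof.
move=> pg ch hL [maxl minx].
have [gN [x1 gx1]] := esepsum_proper pg.
have := maxl (grad (fine \o h) 0); have := minx x1.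
have := gN x1; have := gN xbar; have := conjugate_neqNy lbar hL.1.
rewrite /lagrangian (conjugate_grad 0 ch hL).
case: (esepsum g x1) gx1 => // c _.
case: (esepsum g xbar) => [b||] //; case: (conjugate h lbar) => [a||] //.
by exists a, b.
Qed.

(** [argmin_subgradient] gives the conditions at [xbar]. Since [xs] is only known to minimize the
    objective, strong convexity of [f] has to identify it with [xbar]. *)
Lemma saddle_kkt (R : realType) n p (d : 'I_n -> nat) (l_ mu_ : 'I_n -> R) (l mu L : R)
    (f : forall i, 'cV[R]_(d i) -> R) (g : forall i, 'cV[R]_(d i) -> \bar R)
    (h : 'cV[R]_p -> \bar R) (A : forall i, 'M[R]_(p, d i)) xs xbar lbar
    (s := (\mxrow_i A i) *m xs) :
    0 < mu -> (forall i, mu <= mu_ i) -> (forall i, l_ i <= l) ->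
    (forall i, lsmooth (l_ i) (f i)) -> (forall i, strongly_convex (mu_ i) (f i)) ->
    (forall i, eproper (g i)) -> (forall i, econvex (g i)) ->
    econvex h -> 0 < L -> elsmooth L h ->
    solution f g h A xs -> saddle_point (lagrangian f g h A) xbar lbar ->
  exists a b, [/\ conjugate h lbar = a%:E, esepsum g xs = b%:E,
    forall z, ((b - dotp (grad (sepsum f) xs) (z - xs)
                - dotp lbar ((\mxrow_i A i) *m (z - xs)))%:E <= esepsum g z)%E
  & forall z, ((a + dotp s (z - lbar) + L^-1 / 2 * dotp (z - lbar) (z - lbar))%:E
               <= conjugate h z)%E].
Proof.
move=> mu0 mumu ll fl fc pg cg ch L0 hL sol sad.
have [a [b [la xb]]] := saddle_finite pg ch hL sad.
have [gN _] := esepsum_proper pg.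
have scg := esepsum_strongly_econvex (fun i => (pg i).1)
  (fun i => econvex_strongly (@cg i)).
pose M := \mxrow_i A i; rewrite -/M in s *.
have kktx z : ((b - dotp (grad (sepsum f) xbar) (z - xbar)
                - dotp lbar (M *m (z - xbar)))%:E <= esepsum g z)%E.
  pose F x := sepsum f x + dotp lbar (M *m x).
  have := @argmin_subgradient _ _ 0 (esepsum g) F xbar (z - xbar) b
    (dotp (grad (sepsum f) xbar) (z - xbar) + dotp lbar (M *m (z - xbar)))
    (l / 2 * dotp (z - xbar) (z - xbar)) scg xb.
  rewrite subrKC mul0r mul0r addr0 opprD addrA; apply => [x|t _].
    have := sad.2 x; rewrite /lagrangian la -/M xb.
    have := gN x; case: (esepsum g x) => [c||] // _; last by rewrite addye ?leey.
    by rewrite -!EFinD !lee_fin /F; lra.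
  have := sepsum_descent xbar (t *: (z - xbar)) fl ll.
  by rewrite /F mulmxDr -!scalemxAr !dotp_lin; lra.
have kktl z : ((a + dotp (M *m xbar) (z - lbar)
    + L^-1 / 2 * dotp (z - lbar) (z - lbar))%:E <= conjugate h z)%E.
  have := @argmin_subgradient _ _ L^-1 (conjugate h) (fun x => - dotp x (M *m xbar)) lbar
    (z - lbar) a (- dotp (M *m xbar) (z - lbar)) 0
    (conjugate_strongly_econvex L0 hL) la.
  rewrite subrKC opprK; apply => [x|t _].
    have := sad.1 x; rewrite /lagrangian la -/M xb.
    have := conjugate_neqNy x hL.1.
    case: (conjugate h x) => [c||] // _; last by rewrite addye ?leey.
    by rewrite -!EFinD !lee_fin; lra.
  by rewrite !dotp_lin (dotpC z) (dotpC lbar); lra.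
suff E : xs = xbar by rewrite /s E; exists a, b.
have hr x : h x = (fine (h x))%:E by rewrite fineK // hL.1.
(* Half of the Fenchel equality at the saddle point, from [kktl] at the gradient of [h]. Together
   with [le2] it gives [h (M xs) >= h (M xbar) + lbar . M (xs - xbar)]. *)
have le1 : a <= dotp lbar (M *m xbar) - fine (h (M *m xbar)).
  have := kktl (grad (fine \o h) (M *m xbar)).
  rewrite (conjugate_grad _ ch hL) lee_fin /= dotpDr dotpNr.
  set z := grad _ _; have : 0 <= L^-1 / 2 * dotp (z - lbar) (z - lbar).
    by rewrite mulr_ge0 ?dotp_ge0 // divr_ge0 // invr_ge0 ltW.
  by rewrite (dotpC _ z) (dotpC _ lbar); lra.
have := conjugate_ge h lbar (M *m xs); rewrite la hr -EFinB lee_fin => le2.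
have := sol xbar; rewrite !objectiveE -/M xb (hr (M *m xs)) (hr (M *m xbar)).
have := gN xs; case xsc : (esepsum g xs) => [c||] // _ .
rewrite -!EFinD lee_fin => le3.
have := kktx xs; rewrite xsc lee_fin => le4.
have := sepsum_strongly_convex_gradient xbar (xs - xbar) fl fc mumu.
rewrite subrKC => le5.
(* The sum of the other inequalities bounds the objective at [xs] below by its value at [xbar] plus
   [mu / 2 |xs - xbar|^2], while [le3] bounds it above by that value. *)
have le6 : dotp (xs - xbar) (xs - xbar) <= 0.
  have mu2 : 0 < mu / 2 by rewrite divr_gt0.
  rewrite -(pmulr_rle0 _ mu2); move: le4 le2.
  by rewrite mulmxBr (dotpDr (M *m xs)) (dotpNr (M *m xbar)); lra.
apply/eqP; rewrite -subr_eq0; apply/eqP/dotp_eq0/eqP.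
by rewrite eq_le le6 dotp_ge0.
Qed.

(** * The Lyapunov inequality *)

(** For [c > 0] and [z = C u], the hypothesis makes [|z|^2 - 2 u.z] at most [- (2 - c) / c |z|^2],
    which absorbs [- 2 z.w] at the cost of [c / (2 - c) |w|^2]; and
    [1 + c / (2 - c) = 2 / (2 - c)]. *)
Lemma mixing_bound (R : realType) m (C : 'M[R]_m) (c : R) (u w : 'cV[R]_m) (v := u - C *m u + w) :
    0 <= c < 1 -> dotp (C *m u) (C *m u) <= c * dotp u (C *m u) ->
  (2 - c) * dotp v v <= (2 - c) * (dotp u u + 2 * dotp u w) + 2 * dotp w w.
Proof.
move=> /andP[c0 c1] Cu; rewrite /v !dotp_lin.
rewrite (dotpC (C *m u) u) (dotpC w u) (dotpC w (C *m u)).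
move: (C *m u) Cu => z Cu.
(* The case [c = 0] forces [z = 0]; it is split off because the inequality is multiplied by [c]
   below. *)
have [c00|cn0] := eqVneq c 0.
  have : z = 0 by apply: dotp_eq0; have := dotp_ge0 z; move: Cu; rewrite c00; lra.
  by move=> ->; rewrite !dotp0r !dotp0l c00; lra.
have cp : 0 < c by rewrite lt_neqAle eq_sym cn0.
rewrite -(ler_pM2l cp).
have := dotp_ge0 (c *: w + (2 - c) *: z); rewrite !dotp_lin (dotpC w z); nra.
Qed.

(** Here the step-size bound on [beta] enters: the strong convexity terms absorb the squared
    coupling left over by [mixing_bound]. *)
Lemma coupling_bound (R : realType) m (e d : 'cV[R]_m) (mu beta c theta s2 : R)
    (N : R) (v := e + theta *: d) :
    0 <= c < 1 -> 0 <= theta <= 1 -> 0 <= beta -> 0 <= s2 ->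
    beta * (s2 * (1 / (1 - c) + theta)) <= mu -> N <= s2 * dotp v v ->
  2 * beta * N <= (2 - c) * (mu * (dotp e e + theta * dotp d d)).
Proof.
move=> /andP[c0 c1] /andP[t0 t1] b0 s0 bmu Nv.
have vv : dotp v v <= (1 + theta) * (dotp e e + theta * dotp d d).
  have := mulr_ge0 t0 (dotp_ge0 (e - d)).
  by rewrite /v !dotp_lin (dotpC d e); nra.
set E := dotp e e + _ in vv *.
have E0 : 0 <= E by rewrite /E addr_ge0 ?mulr_ge0 ?dotp_ge0.
(* Equivalent to [c * theta <= c / (1 - c)], which follows from [theta <= 1]. *)
have key : 2 * (1 + theta) <= (2 - c) * (1 / (1 - c) + theta).
  have : c * theta <= c / (1 - c).
    rewrite ler_wpM2l // (le_trans t1) // -div1r ler_pdivlMr ?subr_gt0 // mul1r; lra.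
  have -> : 1 / (1 - c) = 1 + c / (1 - c) by field; lra.
  have -> : (2 - c) * (1 + c / (1 - c) + theta) = 2 + c / (1 - c) + 2 * theta - c * theta.
    by field; lra.
  lra.
have bs0 : 0 <= beta * s2 by rewrite mulr_ge0.
have le1 : 2 * beta * N <= 2 * (beta * s2) * ((1 + theta) * E).
  have := ler_wpM2l b0 Nv; have := ler_wpM2l bs0 vv; lra.
apply: le_trans le1 _.
have := ler_wpM2l (mulr_ge0 bs0 E0) key.
have c2 : 0 <= 2 - c by lra.
have := ler_wpM2l (mulr_ge0 c2 E0) bmu; lra.
Qed.

(** Twice the first prox inequality plus [2 * theta] times the second. Young's inequality handles
    [theta * dotp phi d], and the bounds on [l] and [mu] make the total coefficient of [dotp d d]
    nonpositive. *)
Lemma primal_bound (R : realType) m (e e' z phi : 'cV[R]_m) (alpha theta mu l G G' : R)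
    (d := e' - e) :
    0 < alpha -> 0 <= theta -> 0 <= mu ->
    l <= alpha^-1 -> mu <= alpha^-1 ->
    dotp z e' <= alpha^-1 * dotp (e - e') e' - dotp phi e' - G' ->
    dotp z d <= G - G' - alpha^-1 * dotp d d - dotp phi d ->
    mu / 2 * (dotp e e + dotp e' e') - l / 2 * dotp d d <= dotp phi e' ->
    dotp phi phi <= l ^+ 2 * dotp e e ->
  2 * dotp z (e' + theta *: d) + mu * (dotp e' e' + theta * dotp d d) <=
    (alpha^-1 - mu + 2 * theta * alpha * l ^+ 2) * dotp e e - alpha^-1 * dotp e' e'
    - 2 * (1 + theta) * G' + 2 * theta * G.
Proof.
have ed : d = e' - e by []; clearbody d.
move=> a0 t0 mu0 la mua H1 H2 H3 H4.
(* The factor [2 * alpha] on [dotp phi phi] becomes the term [2 * theta * alpha * l ^+ 2] of the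
   rate. *)
have young : - 2 * dotp phi d <= alpha^-1 / 2 * dotp d d + 2 * alpha * dotp phi phi.
  have := mulr_ge0 (ltW a0) (dotp_ge0 (2 *: phi + alpha^-1 *: d)).
  have -> : alpha * dotp (2 *: phi + alpha^-1 *: d) (2 *: phi + alpha^-1 *: d) =
      4 * alpha * dotp phi phi + 4 * dotp phi d + alpha^-1 * dotp d d.
    by rewrite !dotp_lin (dotpC d phi); field; rewrite gt_eqF.
  lra.
have polar : 2 * dotp (e - e') e' = dotp e e - dotp e' e' - dotp d d.
  by rewrite ed !dotp_lin (dotpC e' e); ring.
have D0 := dotp_ge0 d.
have ia0 : 0 <= alpha^-1 by rewrite invr_ge0 ltW.
have dz : dotp z (e' + theta *: d) = dotp z e' + theta * dotp z d by rewrite !dotp_lin.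
rewrite {}dz.
have H2' := ler_wpM2l t0 H2.
have young' := ler_wpM2l t0 young.
have H4' := ler_wpM2l (mulr_ge0 t0 (ltW a0)) H4.
have H5 := ler_wpM2r D0 la.
have H6 := ler_wpM2r (mulr_ge0 t0 D0) mua.
have H7 := mulr_ge0 ia0 (mulr_ge0 t0 D0).
have E1 : alpha^-1 * dotp (e - e') e' = alpha^-1 * (dotp e e - dotp e' e' - dotp d d) / 2.
  by rewrite -polar; field; rewrite gt_eqF.
rewrite {}E1 in H1.
move: {polar ed D0} H1 H2' H3 young' H4' H5 H6 H7.
move: (dotp d d) (dotp e e) (dotp e' e') (dotp z d) (dotp z e').
move: (dotp phi d) (dotp phi e') (dotp phi phi) => *.
lra.
Qed.

(** Symmetry of [B] matches the cross term of [|y'|^2] with that of [|v + B y|^2]. In use, [u]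
    stands for all of the [v] update except [- B y]. *)
Lemma dual_identity (R : realType) m (B : 'M[R]_m) (u v y : 'cV[R]_m) (gamma : R)
    (y' := y + gamma *: (B *m v)) :
    B^T = B -> v = u - B *m y ->
  gamma * dotp v v - gamma ^+ 2 * dotp (B *m v) (B *m v) + dotp y' y' =
  dotp y y - gamma * dotp (B *m y) (B *m y) + gamma * dotp u u.
Proof.
move=> BT vu; have -> : u = v + B *m y by rewrite vu subrK.
rewrite /y' !dotp_lin (dotpC (B *m v) y) (dotpC v (B *m y)).
have -> : dotp y (B *m v) = dotp (B *m y) v by rewrite dotp_mulmxr BT.
ring.
Qed.

(** Adding the two strong subgradient inequalities gives [(1 + be * ms) |d|^2 <= (w - ws) . d];
    Cauchy-Schwarz does the rest. *)
Lemma strong_prox_contraction (R : realType) m (be ms b bs : R)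
    (w ws u us : 'cV[R]_m) (d := u - us) :
    0 < be -> 0 <= ms ->
    b + be^-1 * dotp (w - u) (us - u) + ms / 2 * dotp (us - u) (us - u) <= bs ->
    bs + be^-1 * dotp (ws - us) (u - us) + ms / 2 * dotp (u - us) (u - us) <= b ->
  (1 + be * ms) ^+ 2 * dotp d d <= dotp (w - ws) (w - ws).
Proof.
have ed : u = us + d by rewrite /d subrKC.
move=> b0 ms0; rewrite -[us - u]opprB -/d !dotpNl !dotpNr opprK.
clearbody d => H1 H2.
have H : (1 + be * ms) * dotp d d <= dotp (w - ws) d.
  have : ms * dotp d d <= be^-1 * (dotp (w - ws) d - dotp d d).
    have <- : dotp (w - u) d - dotp (ws - us) d = dotp (w - ws) d - dotp d d.
      by rewrite ed !dotp_lin; ring.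
    lra.
  by move=> /(ler_wpM2l (ltW b0)); rewrite mulVKf ?gt_eqF //; lra.
have [->|d0] := eqVneq d 0; first by rewrite dotp0l mulr0 dotp_ge0.
have dd := dotp_gt0 d0.
rewrite -(ler_pM2r dd) (le_trans _ (cauchy_schwarz _ _)) //.
have -> : (1 + be * ms) ^+ 2 * dotp d d * dotp d d = ((1 + be * ms) * dotp d d) ^+ 2 by ring.
by rewrite ler_pXn2r ?nnegrE // ?(le_trans _ H) // mulr_ge0 ?addr_ge0 ?mulr_ge0 // ltW.
Qed.

Lemma lyapunov_step (R : realType) m k (Ab : 'M[R]_(k, m)) (Bb Cb : 'M[R]_k)
    (e e' phi : 'cV[R]_m) (u u' y : 'cV[R]_k)
    (alpha beta gamma theta mu l c sA sB sb q G G' : R)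
    (d := e' - e) (v := u - Cb *m u - Bb *m y + beta *: (Ab *m (e' + theta *: d)))
    (y' := y + gamma *: (Bb *m v)) :
    0 < alpha -> 0 < beta -> 0 < gamma -> 0 <= theta <= 1 -> 0 <= c < 1 ->
    0 <= mu -> 0 <= sA -> l <= alpha^-1 -> mu <= alpha^-1 -> 0 <= 1 - gamma * sB ->
    beta * (sA * (1 / (1 - c) + theta)) <= mu ->
    Bb^T = Bb -> dotp (Cb *m u) (Cb *m u) <= c * dotp u (Cb *m u) ->
    (forall w, dotp (Ab *m w) (Ab *m w) <= sA * dotp w w) ->
    (forall w, dotp (Bb *m w) (Bb *m w) <= sB * dotp w w) ->
    sb * dotp y y <= dotp (Bb *m y) (Bb *m y) ->
    q * dotp u' u' <= dotp v v ->
    dotp u (Ab *m e') <= alpha^-1 * dotp (e - e') e' - dotp phi e' - G' ->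
    dotp u (Ab *m d) <= G - G' - alpha^-1 * dotp d d - dotp phi d ->
    mu / 2 * (dotp e e + dotp e' e') - l / 2 * dotp d d <= dotp phi e' ->
    dotp phi phi <= l ^+ 2 * dotp e e ->
  q * (1 - gamma * sB) * dotp u' u' + gamma^-1 * dotp y' y'
    + beta * alpha^-1 * dotp e' e' + 2 * beta * (1 + theta) * G' <=
  dotp u u + (1 - gamma * sb) * (gamma^-1 * dotp y y)
    + beta * alpha^-1 * ((1 - alpha * (mu - 2 * theta * alpha * l ^+ 2)) * dotp e e)
    + 2 * beta * theta * G.
Proof.
move=> a0 b0 g0 t01 c01 mu0 sA0 la mua gs0 bmu BT Cu leA leB By qu P1 P2 P3 P4.
have /andP[t0 t1] := t01; have /andP[c0 c1] := c01.
rewrite !dotp_mulmxr in P1 P2.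
have primal := primal_bound a0 t0 mu0 la mua P1 P2 P3 P4.
rewrite -dotp_mulmxr -/d in primal.
have coupl := coupling_bound (d := d) c01 t01 (ltW b0) sA0 bmu (leA (e' + theta *: d)).
set z := Ab *m _ in v y' qu primal coupl *.
have dual := @dual_identity _ _ Bb (u - Cb *m u + beta *: z) v y gamma BT.
have mix := mixing_bound (beta *: z) c01 Cu.
rewrite -/y' in dual; have {}dual := dual (addrAC _ _ _).
have c2 : 0 < 2 - c by lra.
have {}mix : dotp (u - Cb *m u + beta *: z) (u - Cb *m u + beta *: z) <=
    dotp u u + beta * (2 * dotp u z + mu * (dotp e' e' + theta * dotp d d)).
  rewrite -(ler_pM2l c2) (le_trans mix) // !(dotpZr, dotpZl).
  by have := ler_wpM2l (ltW b0) coupl; lra.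
have {}primal := le_trans mix (lerD (lexx _) (ler_wpM2l (ltW b0) primal)).
(* With [leB], this bounds [|v|^2 - gamma |B v|^2] below by [q (1 - gamma sB) |u'|^2]. *)
have {}qu := ler_wpM2l gs0 qu.
have {}leB := ler_wpM2l (ltW g0) (leB v).
have ig0 : 0 < gamma^-1 by rewrite invr_gt0.
have {}dual : dotp v v - gamma * dotp (Bb *m v) (Bb *m v) + gamma^-1 * dotp y' y' =
    gamma^-1 * dotp y y - dotp (Bb *m y) (Bb *m y)
    + dotp (u - Cb *m u + beta *: z) (u - Cb *m u + beta *: z).
  apply: (mulfI (lt0r_neq0 g0)); transitivity
    (gamma * dotp v v - gamma ^+ 2 * dotp (Bb *m v) (Bb *m v) + dotp y' y').
    by field; rewrite gt_eqF.
  by rewrite dual; field; rewrite gt_eqF.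
have E1 : (1 - gamma * sb) * (gamma^-1 * dotp y y) = gamma^-1 * dotp y y - sb * dotp y y.
  by field; rewrite gt_eqF.
have E2 : beta * alpha^-1 * ((1 - alpha * (mu - 2 * theta * alpha * l ^+ 2)) * dotp e e) =
    beta * ((alpha^-1 - mu + 2 * theta * alpha * l ^+ 2) * dotp e e).
  by field; rewrite gt_eqF.
rewrite E1 E2; clearbody v y' z d; clear -dual primal qu leB By.
lra.
Qed.

(** Ensures that the gap term contracts as well. With [t = alpha * mu] and [mu <= l] it suffices to
    bound [1 - t + 2 theta t^2] below on [0, 1]. *)
Lemma rate_lower_bound (R : realType) (alpha mu theta l : R) :
  0 <= alpha -> 0 <= mu <= l -> alpha * mu <= 1 -> 0 <= theta <= 1 ->
  theta <= (1 + theta) * (1 - alpha * (mu - 2 * theta * alpha * l ^+ 2)).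
Proof.
move=> a0 /andP[mu0 mul] t1 /andP[th0 th1].
set t := alpha * mu in t1.
have t0 : 0 <= t by rewrite mulr_ge0.
have tl : t ^+ 2 <= (alpha * l) ^+ 2.
  by rewrite ler_pXn2r ?nnegrE ?mulr_ge0 ?ler_wpM2l // (le_trans mu0).
have le1 : 1 - t + 2 * theta * t ^+ 2 <= 1 - alpha * (mu - 2 * theta * alpha * l ^+ 2).
  by have := ler_wpM2l th0 tl; rewrite /t; lra.
have th1' : 0 <= 1 + theta by lra.
apply: le_trans (ler_wpM2l th1' le1).
(* Up to [theta = 1/4] the quadratic decreases on [0, 1], with minimum [2 theta] at [t = 1]; above,
   its minimum is at the vertex [1 / (4 theta)]. *)
have [th4|th4] := leP theta (1 / 4).
  have : 0 <= (1 - t) * (1 + theta) * (1 - 2 * theta * (1 + t)).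
    by rewrite !mulr_ge0 //; [lra | nra].
  by have := mulr_ge0 th0 th0; lra.
have th8 : 0 < 8 * theta by lra.
rewrite -(ler_pM2l th8).
have := mulr_ge0 th1' (sqr_ge0 (4 * theta * t - 1)); nra.
Qed.

Lemma hbar_repcol_subgradient (R : realType) n p (h : 'cV[R]_p -> \bar R) (L a b : R)
    (s lbar : 'cV[R]_p) (lam : 'cV[R]_(\sum_(i < n) p)) (e := lam - repcol n lbar) :
    (0 < n)%N -> (forall x, h x \is a fin_num) ->
    (forall z, ((a + dotp s (z - lbar) + L^-1 / 2 * dotp (z - lbar) (z - lbar))%:E
               <= conjugate h z)%E) ->
    hbar h lam = b%:E ->
  a + n%:R^-1 * dotp (repcol n s) e + (n%:R * L)^-1 / 2 * dotp e e <= b.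
Proof.
move=> n0 hfin ha; rewrite /hbar.
have hN i : conjugate h (submxcol lam i) != -oo%E by exact: conjugate_neqNy.
have nn0 : 0 < n%:R :> R by rewrite ltr0n.
case Es : (\sum_i _)%E => [c||]; rewrite ?gt0_muleNy ?gt0_muley ?lte_fin ?invr_gt0 //.
have [Efin ->] := esum_EFin hN Es.
rewrite -EFinM => -[<-]; rewrite invfM -(ler_pM2l nn0) mulVKf ?gt_eqF //.
have -> : n%:R * (a + n%:R^-1 * dotp (repcol n s) e + n%:R^-1 * L^-1 / 2 * dotp e e) =
    n%:R * a + dotp (repcol n s) e + L^-1 / 2 * dotp e e.
  by move: L^-1 => r; field; rewrite gt_eqF.
have -> : n%:R * a = \sum_(i < n) a by rewrite sumr_const card_ord mulr_natl.
rewrite !dotp_blocks mulr_sumr -!big_split; apply: ler_sum => i _ /=.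
have := ha (submxcol lam i); rewrite Efin lee_fin.
by rewrite /e submxcolB !mxcolK.
Qed.

(** * Geometric decay, inequalities for one iteration, and step sizes *)

Lemma fmin_le (R : realType) n (hn : (0 < n)%N) (u : 'I_n -> R) i : fmin hn u <= u i.
Proof. exact: bigmin_le. Qed.

Lemma le_fmax (R : realType) n (hn : (0 < n)%N) (u : 'I_n -> R) i : u i <= fmax hn u.
Proof. exact: le_bigmax. Qed.

Lemma fmin_gt0 (R : realType) n (hn : (0 < n)%N) (u : 'I_n -> R) :
  (forall i, 0 < u i) -> 0 < fmin hn u.
Proof. by move=> u0; apply: lt_bigmin. Qed.

(** The recursion starts at index 1, whence the constant [W 1 / delta]. *)
Lemma eqO_geometric (R : realType) (u W : nat -> R) (delta c : R) :
    0 < delta -> 0 < c -> (forall k, (0 < k)%N -> 0 <= c * u k <= W k) ->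
    (forall k, (0 < k)%N -> W k.+1 <= delta * W k) ->
  (fun k => u k : R^o) =O_\oo (fun k => delta ^+ k : R^o).
Proof.
move=> d0 c0 uW WS.
have W0 k : (0 < k)%N -> 0 <= W k by move=> /uW /andP[]; exact: le_trans.
have WE k : (0 < k)%N -> W k <= W 1%N / delta * delta ^+ k.
  case: k => // k _; elim: k => [|k IH]; first by rewrite expr1 divfK // gt_eqF.
  by rewrite (le_trans (WS _ _)) // exprS mulrCA ler_pM2l.
apply/eqOP; near=> K; near=> k.
have k0 : (0 < k)%N by near: k; exact: nbhs_infty_gt.
have /andP[u0 uk] := uW k k0.
have {}u0 : 0 <= u k by move: u0; rewrite pmulr_rge0.
rewrite ger0_norm // ger0_norm ?exprn_ge0 ?(ltW d0) //.
rewrite -(ler_pM2l c0) (le_trans uk) // (le_trans (WE k k0)) // mulrA.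
rewrite ler_wpM2r ?exprn_ge0 ?(ltW d0) // -ler_pdivrMl //.
Unshelve. all: by end_near. Qed.

(** Isolates the coupling of multiplier and primal step; used with [z] equal to the solution and to
    the previous iterate. *)
Lemma prox_gradient_step (R : realType) m k (g : 'cV[R]_m -> \bar R) (M : 'M[R]_(k, m))
    (x x' z gr : 'cV[R]_m) (lam : 'cV[R]_k) (alpha c r : R) :
    0 < alpha -> strongly_econvex 0 g ->
    is_prox alpha g (x - alpha *: (gr + M^T *m lam)) x' -> g x' = c%:E -> g z = r%:E ->
  dotp lam (M *m (x' - z)) <=
    r - c + alpha^-1 * dotp (x - x') (x' - z) - dotp gr (x' - z).
Proof.
move=> a0 cg px xc zr; have := prox_subgradient z a0 cg px xc.
rewrite zr lee_fin mul0r mul0r addr0 -[z - x']opprB dotpNr.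
rewrite (addrAC x) (dotpDl (x - x')) dotpNl dotpZl (dotpDl gr) -dotp_mulmxr.
move: (x' - z) (x - x') => d e.
have -> : alpha^-1 * - (dotp e d - alpha * (dotp gr d + dotp lam (M *m d))) =
    - (alpha^-1 * dotp e d) + (dotp gr d + dotp lam (M *m d)).
  by field; rewrite gt_eqF.
lra.
Qed.

(* Descent from [x] to [x'] combined with strong convexity at [x] and at [xs]. *)
Lemma sepsum_gradient_monotone (R : realType) n (d : 'I_n -> nat) (l_ mu_ : 'I_n -> R)
    (l mu : R) (f : forall i, 'cV[R]_(d i) -> R) (x x' xs : 'cV[R]_(\sum_i d i)) :
    (forall i, lsmooth (l_ i) (f i)) -> (forall i, strongly_convex (mu_ i) (f i)) ->
    (forall i, mu <= mu_ i) -> (forall i, l_ i <= l) ->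
  mu / 2 * (dotp (x - xs) (x - xs) + dotp (x' - xs) (x' - xs))
    - l / 2 * dotp (x' - x) (x' - x) <=
  dotp (grad (sepsum f) x - grad (sepsum f) xs) (x' - xs).
Proof.
move=> fl fc mumu ll.
have := sepsum_strongly_convex_gradient x (xs - x) fl fc mumu.
have := sepsum_strongly_convex_gradient xs (x' - xs) fl fc mumu.
have := sepsum_descent x (x' - x) fl ll.
rewrite !subrKC -[xs - x]opprB !(dotpNl, dotpNr, dotpDl) opprK.
have : dotp (grad (sepsum f) x) (x' - xs) =
    dotp (grad (sepsum f) x) (x' - x) + dotp (grad (sepsum f) x) (x - xs).
  by rewrite -dotpDr addrA subrK.
move: (x' - x) (x - xs) (x' - xs) => e e' e''; lra.
Qed.

(** [ws] is the point whose prox is [repcol n lbar]: [s] is a subgradient of the conjugate at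
    [lbar], and the weight [1/n] in [hbar] turns the shift [beta] into [beta / n]. *)
Lemma hbar_prox_contraction (R : realType) n p (h : 'cV[R]_p -> \bar R)
    (L a beta : R) (s lbar : 'cV[R]_p) (w lam : 'cV[R]_(\sum_(i < n) p))
    (ws := repcol n (lbar + (beta / n%:R) *: s)) (d := lam - repcol n lbar) :
    (0 < n)%N -> 0 < L -> elsmooth L h -> 0 < beta ->
    conjugate h lbar = a%:E ->
    (forall z, ((a + dotp s (z - lbar) + L^-1 / 2 * dotp (z - lbar) (z - lbar))%:E
               <= conjugate h z)%E) ->
    is_prox beta (@hbar R n p h) w lam ->
  (1 + beta / (n%:R * L)) ^+ 2 * dotp d d <= dotp (w - ws) (w - ws).
Proof.
move=> n0 L0 hL b0 la kl pw.
have [b lb] := prox_finite (hbar_proper n0 hL.1 la) pw.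
have nL0 : 0 <= (n%:R * L)^-1 by rewrite invr_ge0 mulr_ge0 // ltW.
apply: (@strong_prox_contraction _ _ beta (n%:R * L)^-1 b a) => //.
  have := prox_subgradient (repcol n lbar) b0 (hbar_strongly_econvex n0 L0 hL) pw lb.
  by rewrite (hbar_repcol n0 la) lee_fin.
have := hbar_repcol_subgradient n0 hL.1 kl lb.
have -> : ws - repcol n lbar = (beta / n%:R) *: repcol n s.
  by rewrite /ws !repcolE mulmxDr -scalemxAr addrAC subrr add0r.
rewrite dotpZl; move: (lam - repcol n lbar) => e.
have -> : beta^-1 * (beta / n%:R * dotp (repcol n s) e) = n%:R^-1 * dotp (repcol n s) e.
  by rewrite -mulrA mulKf // gt_eqF.
by [].
Qed.

(** [1 / alpha > 2 * l - mu >= l >= mu] gives the first two bounds; the other entry of the maximum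
    gives the third. *)
Lemma step_size_bounds (R : realType) (alpha theta mu l : R) :
    0 < mu <= l -> 0 < alpha -> 0 <= theta ->
    alpha < 1 / Num.max (2 * theta * l ^+ 2 / mu) (2 * l - mu) ->
  [/\ l <= alpha^-1, mu <= alpha^-1 & 2 * theta * alpha * l ^+ 2 < mu].
Proof.
move=> /andP[mu0 mul] a0 th0.
have m0 : 0 < Num.max (2 * theta * l ^+ 2 / mu) (2 * l - mu).
  by rewrite lt_max; apply/orP; right; lra.
rewrite div1r -[X in X < _]invrK ltf_pV2 ?posrE ?invr_gt0 // gt_max => /andP[lt1 lt2].
split; try lra.
move: lt1; rewrite ltr_pdivrMr // -(ltr_pM2l a0) mulVKf ?gt_eqF //; lra.
Qed.

Theorem theorem4 (R : realType) (n p : nat) (hn : (0 < n)%N) (d : 'I_n -> nat)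
    (f : forall i, 'cV[R]_(d i) -> R) (g : forall i, 'cV[R]_(d i) -> \bar R)
    (h : 'cV[R]_p -> \bar R) (A : forall i, 'M[R]_(p, d i))
    (edge : rel 'I_n) (B C D : 'M[R]_n) (mu_ l_ : 'I_n -> R)
    (lh alpha beta gamma theta : R)
    (x : nat -> 'cV[R]_(\sum_i d i)) (y lam : nat -> 'cV[R]_(\sum_(i < n) p))
    (xs : 'cV[R]_(\sum_i d i)) :
  let mu := fmin hn mu_ in
  let l := fmax hn l_ in
  let q := (1 + beta / (n%:R * lh)) ^+ 2 in
  let delta := Num.max
    (Num.max (1 - alpha * (mu - 2 * theta * alpha * l ^+ 2))
             (1 / (q * (1 - gamma * sigma_max B ^+ 2))))
    (1 - gamma * sigma_min B ^+ 2) in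
  (* the solution of the problem, and assumptions (1)-(5) *)
  solution f g h A xs ->
  (exists xbar lbar, saddle_point (lagrangian f g h A) xbar lbar) ->
  symmetric edge -> (forall i j, connect edge i j) ->
  (forall i, 0 < mu_ i <= l_ i) ->
  (forall i, strongly_convex (mu_ i) (f i)) ->
  (forall i, lsmooth (l_ i) (f i)) ->
  (forall i, proper_convex_lsc (g i)) ->
  proper_convex_lsc h ->
  B^T = B -> C^T = C -> D^T = D ->
  C = 0 \/ null_is_span1 C ->
  null_is_span1 B ->
  loewner_le 0 C -> loewner_lt C 1%:M ->
  loewner_le (B *m B) 1%:M ->
  doubly_stochastic D ->
  0 < lh -> elsmooth lh h ->
  (* parameters *)
  0 <= theta <= 1 -> 0 < alpha -> 0 < beta -> 0 < gamma ->
  alpha < 1 / Num.max (2 * theta * l ^+ 2 / mu) (2 * l - mu) ->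
  beta * (sigma_max (blockdiag A) ^+ 2 * (1 / (1 - sigma_max C) + theta)) <= mu ->
  gamma < Num.min 1 ((q - 1) / (q * sigma_max B ^+ 2)) ->
  (* the iteration *)
  y 0%N = 0 ->
  (forall k, npga_step f g h A B C D alpha beta gamma theta
               (x k) (y k) (lam k) (x k.+1) (y k.+1) (lam k.+1)) ->
  0 < delta < 1 /\
  (fun k => enorm (x k - xs) ^+ 2 : R^o) =O_\oo (fun k => delta ^+ k : R^o).
Proof.
move=> mu l q delta sol [xbar [lbar sad]] _ _ mul fc fl pclg pclh BT CT DT nullC nullB
  C0 C1 _ dsD lh0 hL t01 a0 b0 g0 alt bet gam y0 steps.
have [pg cg] : (forall i, eproper (g i)) /\ (forall i, econvex (g i)).
  by split=> i; case: (pclg i).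
have [_ ch _] := pclh.
have mu0 : 0 < mu by apply: fmin_gt0 => i; case/andP: (mul i).
have mumu i : mu <= mu_ i by exact: fmin_le.
have ll i : l_ i <= l by exact: le_fmax.
have lel : mu <= l.
  by rewrite (le_trans (mumu (Ordinal hn))) // (le_trans _ (ll (Ordinal hn))) //;
    case/andP: (mul (Ordinal hn)).
have l0 i : 0 <= l_ i <= l.
  by rewrite ll andbT (le_trans _ (andP (mul i)).2) // ltW; case/andP: (mul i).
have nn0 : 0 < n%:R :> R by rewrite ltr0n.
have /andP[t0 t1] := t01.
have [la mua tal] : [/\ l <= alpha^-1, mu <= alpha^-1 & 2 * theta * alpha * l ^+ 2 < mu].
  by apply: step_size_bounds => //; rewrite mu0.
have r0 : 0 < beta / (n%:R * lh) by rewrite divr_gt0 // mulr_gt0.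
have q1 : 1 < q by rewrite /q expr_gt1 //; lra.
have ones0 : const_mx 1 != 0 :> 'cV[R]_n.
  by apply/eqP => /matrixP/(_ (Ordinal hn) 0); rewrite !mxE => /eqP; rewrite oner_eq0.
(* A vanishing [sigma_max B] would make the bound on [gamma] equal to 0, by [x / 0 = 0]. *)
have sB0 : 0 < sigma_max B.
  have [sB _ _] := sigma_max_attained B ones0; rewrite lt_neqAle sB andbT eq_sym.
  apply/eqP => sB00; move: gam; rewrite sB00 expr0n mulr0 invr0 mulr0 lt_min.
  by rewrite [X in _ && X]ltNge (ltW g0) andbF.
have Bn0 : B != 0.
  apply/eqP => B0; have [_ [v + v0] _] := sigma_max_attained B ones0.
  rewrite {1 2}B0 mulmx0 mul0mx => /esym/eqP.
  by rewrite scaler_eq0 (negbTE v0) orbF sqrf_eq0 gt_eqF.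
have [sb0 sbB] := sigma_min_kronI p hn BT nullB Bn0.
have q0 : 0 < q by lra.
(* The bound on [gamma], in the form that makes the second entry of [delta] less than 1. *)
have gB : q * (1 - gamma * sigma_max B ^+ 2) > 1.
  move: gam; rewrite lt_min => /andP[_]; rewrite ltr_pdivlMr ?mulr_gt0 ?exprn_gt0 //; lra.
have gs0 : 0 < 1 - gamma * sigma_max B ^+ 2.
  by rewrite -(pmulr_rgt0 _ q0); lra.
have d3 : 0 < gamma * sigma_min B ^+ 2 by rewrite mulr_gt0 ?exprn_gt0.
have d2 : 0 < 1 / (q * (1 - gamma * sigma_max B ^+ 2)) < 1.
  have Q0 : 0 < q * (1 - gamma * sigma_max B ^+ 2) by lra.
  by rewrite div1r invr_gt0 Q0 invf_lt1.
have d1 : 0 < alpha * (mu - 2 * theta * alpha * l ^+ 2) by rewrite mulr_gt0 // subr_gt0.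
have d01 : 0 < delta < 1.
  case/andP: d2 => d2 d2'.
  rewrite /delta !lt_max !gt_max d2 d2' orbT /= andbT.
  by apply/andP; split; lra.
split => //.
have [a [b [lfin xfin kx kl]]] := saddle_kkt mu0 mumu ll fl fc pg cg ch lh0 hL sol sad.
set M := \mxrow_i A i in kx kl; set s := M *m xs in kl.
set lams := repcol n lbar.
set F := sepsum f in kx.
have scg : strongly_econvex 0 (esepsum g).
  by apply: esepsum_strongly_econvex => i; [exact: (pg i).1 | exact/econvex_strongly/cg].
have MA (z : 'cV_(\sum_i d i)) : dotp lams (blockdiag A *m z) = dotp lbar (M *m z).
  by rewrite dotp_repcol blockdiag_mulmx.
(* [w] is the value that [B ys] must take at a fixed point. Its blocks sum to
   [beta *: s - (n%:R * c) *: s = 0], so it lies in the range of [B]. *)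
pose c := beta / n%:R; pose w := beta *: (blockdiag A *m xs) - c *: repcol n s.
have w0 : sumcol R n p *m w = 0.
  rewrite mulmxBr -!scalemxAr blockdiag_mulmx -/M -/s sumcolE.
  under eq_bigr do rewrite mxcolK.
  by rewrite sumr_const card_ord -scaler_nat scalerA divfK ?subrr // gt_eqF.
have [ys [Bys ys0]] := kronI_range hn BT nullB w0.
(* The value of [v] at the fixed point: a consensus vector, hence annihilated by [B] and preserved
   by [D]. *)
pose vs := repcol n (lbar + c *: s).
have vsE : vs = lams + c *: repcol n s by rewrite /vs /lams !repcolE mulmxDr -scalemxAr.
have Clams : kronI p C *m lams = 0.
  have C1n : C *m (const_mx 1 : 'cV_n) = const_mx 0.
    by case: nullC => [->|/null_is_span1_mul1 ->]; rewrite ?mul0mx.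
  by rewrite (kronI_repcol _ C1n) scale0r repcolE mulmx0.
have Bvs : kronI p B *m vs = 0.
  rewrite (kronI_repcol _ (null_is_span1_mul1 nullB)).
  by rewrite scale0r repcolE mulmx0.
have Dvs : kronI p D *m vs = vs.
  rewrite (@kronI_repcol _ _ _ _ 1) ?scale1r //.
  apply/matrixP => i j; rewrite !mxE; have [_ Dr _] := dsD.
  by rewrite -[RHS](Dr i); apply: eq_bigr => k _; rewrite mxE mulr1.
pose e k := x k - xs; pose u k := lam k - lams; pose yt k := y k - ys.
pose v k := lam k - kronI p C *m lam k - kronI p B *m y k
  + beta *: (blockdiag A *m (x k.+1 + theta *: (x k.+1 - x k))).
have ee k : e k.+1 - e k = x k.+1 - x k by rewrite /e opprB addrA subrK.
have vE k : v k - vs = u k - kronI p C *m u k - kronI p B *m yt k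
    + beta *: (blockdiag A *m (e k.+1 + theta *: (e k.+1 - e k))).
  rewrite ee /e (addrAC (x k.+1)) (mulmxBr _ _ xs) /yt (mulmxBr _ (y k)) Bys /w.
  rewrite /u (mulmxBr _ (lam k)) Clams vsE /v.
  move: (_ *m lam k) (_ *m y k) (_ *m xs) (_ *m (_ + _)) => z1 z2 z3 z4.
  by apply/matrixP => i j; rewrite !mxE; ring.
have yE k : yt k.+1 = yt k + gamma *: (kronI p B *m (v k - vs)).
  rewrite (mulmxBr _ (v k)) Bvs subr0 /yt (addrAC (y k)).
  by have [_ -> _] := steps k.
(* Started at 0, [y k] never leaves the range of [B], so its error stays where [sigma_min B] bounds
   [kronI p B] from below. *)
have yt0 k : sumcol R n p *m yt k = 0.
  elim: k => [|k IH]; first by rewrite /yt y0 sub0r mulmxN ys0 oppr0.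
  by rewrite yE mulmxDr IH -scalemxAr sumcol_kronI // scaler0 addr0.
(* At [k = 0], where [g] may be infinite, [fine] returns a default value; prox outputs have finite
   [g], hence the index [k.+1] from here on. *)
pose gk k := fine (esepsum g (x k)).
have gkE k : esepsum g (x k.+1) = (gk k.+1)%:E.
  by have [/(prox_finite (esepsum_proper pg))[r] + _ _] := steps k; rewrite /gk => ->.
(* Bregman-type gap of [g] at [x k]; it absorbs the extrapolation term [theta *: (x' - x)]. *)
pose G k := gk k - b + dotp (grad F xs) (e k) + dotp lbar (M *m e k).
have G0 k : 0 <= G k.+1.
  by have := kx (x k.+1); rewrite gkE lee_fin /G /e; lra.
have Cpsd : psdmx C by move=> z; have := C0 z; rewrite subr0.
have c01 : 0 <= sigma_max C < 1 by exact: sigma_max_psd_lt1.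
pose Q := q * (1 - gamma * sigma_max B ^+ 2).
have Q0 : 0 < Q by rewrite mulr_gt0.
pose W k := Q * dotp (u k) (u k) + gamma^-1 * dotp (yt k) (yt k)
  + beta * alpha^-1 * dotp (e k) (e k) + 2 * beta * (1 + theta) * G k.
have WS k : W k.+2 <= dotp (u k.+1) (u k.+1)
    + (1 - gamma * sigma_min B ^+ 2) * (gamma^-1 * dotp (yt k.+1) (yt k.+1))
    + beta * alpha^-1 * ((1 - alpha * (mu - 2 * theta * alpha * l ^+ 2)) * dotp (e k.+1) (e k.+1))
    + 2 * beta * theta * G k.+1.
  have [px _ pl] := steps k.+1.
  have := @lyapunov_step _ _ _ (blockdiag A) (kronI p B) (kronI p C) (e k.+1) (e k.+2)
    (grad F (x k.+1) - grad F xs) (u k.+1) (u k.+2) (yt k.+1) alpha beta gamma theta mu l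
    (sigma_max C) (sigma_max (blockdiag A) ^+ 2) (sigma_max B ^+ 2) (sigma_min B ^+ 2) q
    (G k.+1) (G k.+2).
  cbv zeta; rewrite -vE -yE; apply => //; try exact: ltW.
  - exact: sqr_ge0.
  - by rewrite tr_kronI BT.
  - apply: sqr_le_mul_psd; [by rewrite tr_kronI CT | exact: psdmx_kronI | | by case/andP: c01].
    by move=> z; apply: kronI_norm_le; exact: dotp_mulmx_le.
  - exact: dotp_mulmx_le.
  - by move=> z; apply: kronI_norm_le; exact: dotp_mulmx_le.
  - exact: sbB.
  (* Since [D] fixes [vs] and is nonexpansive, the contraction of the dual prox survives the
     multiplication by [D]. *)
  - have DvE : kronI p D *m v k.+1 - vs = kronI p D *m (v k.+1 - vs).
      by rewrite mulmxBr Dvs.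
    have : q * dotp (u k.+2) (u k.+2) <=
        dotp (kronI p D *m v k.+1 - vs) (kronI p D *m v k.+1 - vs).
      exact: hbar_prox_contraction hn lh0 hL b0 lfin kl pl.
    rewrite DvE => /le_trans -> //; rewrite -[leRHS]mul1r.
    by apply: kronI_norm_le => z; rewrite mul1r doubly_stochastic_norm_le.
  - have := prox_gradient_step a0 scg px (gkE k.+1) xfin.
    rewrite -/(e k.+2) /u (dotpDl (lam k.+1)) (dotpNl lams) MA.
    rewrite (dotpDl (grad F (x k.+1))) (dotpNl (grad F xs)) /G.
    rewrite [e k.+1 - e k.+2](_ : _ = x k.+1 - x k.+2); last by rewrite /e opprB addrA subrK.
    lra.
  (* Tested at the previous iterate, where [g] is finite because the index is at least 1; the gap
     [G] telescopes. *)
  - have := prox_gradient_step a0 scg px (gkE k.+1) (gkE k).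
    rewrite -[x k.+1 - x k.+2]opprB -ee dotpNl /u (dotpDl (lam k.+1)) (dotpNl lams) MA.
    rewrite (dotpDl (grad F (x k.+1))) (dotpNl (grad F xs)) /G.
    have -> : dotp lbar (M *m (e k.+2 - e k.+1)) =
        dotp lbar (M *m e k.+2) - dotp lbar (M *m e k.+1).
      by rewrite mulmxBr dotpDr dotpNr.
    have -> : dotp (grad F xs) (e k.+2 - e k.+1) =
        dotp (grad F xs) (e k.+2) - dotp (grad F xs) (e k.+1).
      by rewrite dotpDr dotpNr.
    lra.
  - by rewrite ee; exact: sepsum_gradient_monotone.
  - exact: sepsum_gradient_lipschitz.
apply: (@eqO_geometric _ _ W delta (beta * alpha^-1)).
- by case/andP: d01.
- by rewrite mulr_gt0 // invr_gt0.
- case=> // k _; rewrite sqr_enorm.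
  have Gk : 0 <= 2 * beta * (1 + theta) * G k.+1.
    by rewrite !mulr_ge0 ?G0 ?(ltW b0) //; lra.
  have uk : 0 <= Q * dotp (u k.+1) (u k.+1) by rewrite mulr_ge0 ?dotp_ge0 // ltW.
  have yk : 0 <= gamma^-1 * dotp (yt k.+1) (yt k.+1).
    by rewrite mulr_ge0 ?dotp_ge0 // invr_ge0 ltW.
  have ab : 0 <= beta * alpha^-1 by rewrite mulr_ge0 ?invr_ge0 ?ltW.
  have := mulr_ge0 ab (dotp_ge0 (e k.+1)).
  by rewrite /W -/(e k.+1) => ek; apply/andP; split => //; lra.
- case=> // k _; apply: le_trans (WS k) _.
  have [le1 le2 le3] : [/\ 1 - alpha * (mu - 2 * theta * alpha * l ^+ 2) <= delta,
      1 / Q <= delta & 1 - gamma * sigma_min B ^+ 2 <= delta].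
    by rewrite /delta -/Q !le_max !lexx ?orbT.
  have leu : dotp (u k.+1) (u k.+1) <= delta * (Q * dotp (u k.+1) (u k.+1)).
    by rewrite mulrA ler_peMl ?dotp_ge0 // -ler_pdivrMr.
  have ley : (1 - gamma * sigma_min B ^+ 2) * (gamma^-1 * dotp (yt k.+1) (yt k.+1)) <=
      delta * (gamma^-1 * dotp (yt k.+1) (yt k.+1)).
    by rewrite ler_wpM2r // mulr_ge0 ?dotp_ge0 // invr_ge0 ltW.
  have lee : beta * alpha^-1 *
      ((1 - alpha * (mu - 2 * theta * alpha * l ^+ 2)) * dotp (e k.+1) (e k.+1)) <=
      delta * (beta * alpha^-1 * dotp (e k.+1) (e k.+1)).
    rewrite mulrCA ler_wpM2r // ?mulr_ge0 ?dotp_ge0 ?invr_ge0 //; exact: ltW.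
  (* The gap enters with weight [theta] and leaves with weight [1 + theta]; their ratio is at most
     [delta]. *)
  have leG : 2 * beta * theta * G k.+1 <= delta * (2 * beta * (1 + theta) * G k.+1).
    have thd : theta <= delta * (1 + theta).
      have a1 : alpha * mu <= 1 by rewrite -ler_pdivlMl // mulr1.
      have mul' : 0 <= mu <= l by rewrite lel andbT ltW.
      apply: le_trans (rate_lower_bound (ltW a0) mul' a1 t01) _.
      by rewrite [leRHS]mulrC ler_wpM2l //; lra.
    have bG : 0 <= 2 * beta * G k.+1 by rewrite !mulr_ge0 ?G0 ?(ltW b0).
    by have := ler_wpM2l bG thd; lra.
  rewrite /W; lra.
Qed.
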